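(* Let $1\le n<m$ and fix non-zero complex numbers $q_{ij}$, $1\le i<j\le m$, with $q_{ij}=q_{i'j'}$ for all $i,i'\le n$ and $j,j'>n$. Let $A=(a_{ij})_{m\times m}$ be a $\mathbf q$-Cartier-Foata matrix, i.e. $$q_{kl}\,a_{jl}a_{ik}=q_{ij}\,a_{ik}a_{jl}\ (i<j,\ k<l),\quad a_{jl}a_{ik}=q_{ij}q_{lk}\,a_{ik}a_{jl}\ (i<j,\ k>l),\quad a_{jk}a_{ik}=q_{ij}\,a_{ik}a_{jk}\ (i<j),$$ where $q_{lk}$ for $l<k$ is the given parameter. For $n<i,j\le m$ let $$c^{\mathbf q}_{ij}=-{\det}_{\mathbf q}^{-1}(I-A_0)\cdot{\det}_{\mathbf q}\begin{pmatrix} I-A_0 & -a_{*j}\\ -a_{i*} & -a_{ij}\end{pmatrix},\qquad C^{\mathbf q}=(c^{\mathbf q}_{ij})_{n+1\le i,j\le m}.$$ Then ${\det}_{\mathbf q}^{-1}(I-A_0)\cdot{\det}_{\mathbf q}(I-A)={\det}_{\mathbf q}(I-C^{\mathbf q})$.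
   Context: $\mathcal A$ is the $\mathbb C$-algebra of formal power series in non-commuting variables $a_{ij}$, $1\le i,j\le m$; identities are in the quotient by the closed two-sided ideal generated by the stated relations. $A_0=(a_{ij})_{1\le i,j\le n}$, $a_{i*}=(a_{i1},\dots,a_{in})$, $a_{*j}=(a_{1j},\dots,a_{nj})^T$. For words $\lambda,\mu$ over $\{1,\dots,m\}$, $a_{\lambda,\mu}=a_{\lambda_1\mu_1}\cdots a_{\lambda_\ell\mu_\ell}$, $\mathcal I(\nu)=\{(s,t):s<t,\nu_s>\nu_t\}$, $\operatorname{inv}\nu=|\mathcal I(\nu)|$, and $w(\lambda,\mu)=\prod_{(s,t)\in\mathcal I(\mu)}q_{\mu_t\mu_s}\prod_{(s,t)\in\mathcal I(\lambda)}q_{\lambda_t\lambda_s}^{-1}$. For a square matrix $B=(b_{rs})_{N\times N}$ with row labels $\rho_1<\dots<\rho_N$ and column labels $\kappa_1<\dots<\kappa_N$ in $\{1,\dots,m\}$ and entries linear combinations of $1$ and $a_{\rho_r\kappa_s}$, ${\det}_{\mathbf q}B$ is obtained by expanding $\sum_{\sigma\in S_N}(-1)^{\operatorname{inv}\sigma}b_{\sigma(1)1}\cdots b_{\sigma(N)N}$ into words $a_{\lambda,\mu}$ ($\lambda$ row labels, $\mu$ column labels) and multiplying each by $w(\lambda,\mu)$; this applies to $I-A$, $I-A_0$ and the bordered matrix with rows labelled $1,\dots,n,i$ and columns $1,\dots,n,j$. ${\det}_{\mathbf q}^{-1}(I-A_0)$ is the inverse of ${\det}_{\mathbf q}(I-A_0)$.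 ${\det}_{\mathbf q}(I-C^{\mathbf q})=\sum_{J\subseteq\{n+1,\dots,m\}}(-1)^{|J|}\sum_{\sigma\in S_J}(-1)^{\operatorname{inv}\sigma}w(\sigma(j_1)\cdots\sigma(j_k),j_1\cdots j_k)\,c^{\mathbf q}_{\sigma(j_1)j_1}\cdots c^{\mathbf q}_{\sigma(j_k)j_k}$ for $J=\{j_1<\dots<j_k\}$, treating the $c^{\mathbf q}_{ij}$ as letters. *)

(* Defs.v *)
From HB Require Import structures.
From mathcomp Require Import all_boot all_order all_algebra perm.
From mathcomp Require Import boolp reals.
From mathcomp Require Export complex.

Set Implicit Arguments.
Unset Strict Implicit.
Unset Printing Implicit Defensive.

Import GRing.Theory.
Local Open Scope ring_scope.

(* A series f in non-commuting letters X is its coefficient function on words: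
   f u is the coefficient of the word u.  This is a fresh constant, so it does
   not pick up the pointwise ring structure of function types. *)
Definition ncps (K X : Type) : Type := seq X -> K.

HB.instance Definition _ (K : choiceType) (X : Type) :=
  Choice.copy (ncps K X) (seq X -> K).

Section Ring.
Variables (K : fieldType) (X : Type).
Implicit Types (f g h : ncps K X) (u v w : seq X).

Definition nc_zero : ncps K X := fun=> 0.
Definition nc_opp f : ncps K X := fun w => - f w.
Definition nc_add f g : ncps K X := fun w => f w + g w.
Definition nc_one : ncps K X := fun w => (nilp w)%:R.
Definition nc_mul f g : ncps K X :=
  fun w => \sum_(0 <= i < (size w).+1) f (take i w) * g (drop i w).
Definition nc_scale (a : K) f : ncps K X := fun w => a * f w.

Fact nc_addA : associative nc_add.
Proof. by move=> f g h; apply: funext => w; rewrite /nc_add addrA. Qed.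
Fact nc_addC : commutative nc_add.
Proof. by move=> f g; apply: funext => w; rewrite /nc_add addrC. Qed.
Fact nc_add0 : left_id nc_zero nc_add.
Proof. by move=> f; apply: funext => w; rewrite /nc_add add0r. Qed.
Fact nc_addN : left_inverse nc_zero nc_opp nc_add.
Proof. by move=> f; apply: funext => w; rewrite /nc_add addNr. Qed.

HB.instance Definition _ :=
  GRing.isZmodule.Build (ncps K X) nc_addA nc_addC nc_add0 nc_addN.

Fact nc_mulA : associative nc_mul.
Proof.
move=> f g h; apply: funext => w; rewrite /nc_mul.
have L i : (0 <= i < (size w).+1)%N ->
  f (take i w) * (\sum_(0 <= j < (size (drop i w)).+1)
       g (take j (drop i w)) * h (drop j (drop i w)))
  = \sum_(0 <= k < (size w).+1 | (i <= k)%N)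
       f (take i w) * (g (take (k - i) (drop i w)) * h (drop k w)).
  move=> /andP[_ lti]; rewrite mulr_sumr.
  rewrite [RHS](eq_bigl (fun k => true && (i <= k)%N)) //.
  rewrite -big_nat_widenl //.
  rewrite -[i in RHS](add0n i) big_addn size_drop subSn //.
  by apply: eq_big_nat => j _; rewrite addnK drop_drop.
have R k : (0 <= k < (size w).+1)%N ->
  (\sum_(0 <= i < (size (take k w)).+1)
       f (take i (take k w)) * g (drop i (take k w))) * h (drop k w)
  = \sum_(0 <= i < (size w).+1 | (i <= k)%N)
       f (take i w) * (g (take (k - i) (drop i w)) * h (drop k w)).
  move=> /andP[_ ltk]; rewrite mulr_suml size_takel //.
  rewrite [RHS](eq_bigl (fun i => true && (i < k.+1)%N)) //.
  rewrite -big_nat_widen //; apply: eq_big_nat => i /andP[_ leik].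
  by rewrite take_takel // take_drop subnK // mulrA.
rewrite (eq_big_nat _ _ L) (eq_big_nat _ _ R).
by rewrite [RHS](exchange_big_dep xpredT) //=.
Qed.

Fact nc_mul1l : left_id nc_one nc_mul.
Proof.
move=> f; apply: funext => w; rewrite /nc_mul big_nat_recl // take0 drop0 mul1r.
rewrite big_nat big1 ?addr0 // => i /andP[_ lti].
by rewrite /nc_one /nilp size_takel // mul0r.
Qed.

Fact nc_mul1r : right_id nc_one nc_mul.
Proof.
move=> f; apply: funext => w; rewrite /nc_mul big_nat_recr //=.
rewrite take_size drop_size mulr1.
rewrite big_nat big1 ?add0r // => i /andP[_ lti].
by rewrite /nc_one /nilp size_drop subn_eq0 leqNgt lti mulr0.
Qed.

Fact nc_mulDl : left_distributive nc_mul +%R.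
Proof.
move=> f g h; apply: funext => w; rewrite /nc_mul [RHS]/GRing.add /= /nc_add.
by rewrite -big_split; apply: eq_bigr => i _; exact: mulrDl.
Qed.

Fact nc_mulDr : right_distributive nc_mul +%R.
Proof.
move=> f g h; apply: funext => w; rewrite /nc_mul [RHS]/GRing.add /= /nc_add.
by rewrite -big_split; apply: eq_bigr => i _; exact: mulrDr.
Qed.

Fact nc_one_neq0 : nc_one != 0.
Proof.
by apply/eqP => /(congr1 (fun f : ncps K X => f [::]))/eqP; rewrite oner_eq0.
Qed.

HB.instance Definition _ := GRing.Zmodule_isNzRing.Build (ncps K X)
  nc_mulA nc_mul1l nc_mul1r nc_mulDl nc_mulDr nc_one_neq0.

Fact nc_scaleA a b f : nc_scale a (nc_scale b f) = nc_scale (a * b) f.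
Proof. by apply: funext => w; rewrite /nc_scale mulrA. Qed.
Fact nc_scale1 : left_id 1 nc_scale.
Proof. by move=> f; apply: funext => w; rewrite /nc_scale mul1r. Qed.
Fact nc_scaleDr : right_distributive nc_scale +%R.
Proof. by move=> a f g; apply: funext => w; rewrite /nc_scale mulrDr. Qed.
Fact nc_scaleDl f : {morph nc_scale^~ f : a b / a + b}.
Proof. by move=> a b; apply: funext => w; rewrite /nc_scale mulrDl. Qed.

HB.instance Definition _ := GRing.Zmodule_isLmodule.Build K (ncps K X)
  nc_scaleA nc_scale1 nc_scaleDr nc_scaleDl.

Fact nc_scaleAl a f g : a *: (f * g) = (a *: f) * g.
Proof.
apply: funext => w; rewrite /GRing.scale /GRing.mul /= /nc_scale /nc_mul.
by rewrite mulr_sumr; apply: eq_bigr => i _; rewrite mulrA.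
Qed.

HB.instance Definition _ :=
  GRing.Lmodule_isLalgebra.Build K (ncps K X) nc_scaleAl.

Fact nc_scaleAr a f g : a *: (f * g) = f * (a *: g).
Proof.
apply: funext => w; rewrite /GRing.scale /GRing.mul /= /nc_scale /nc_mul.
by rewrite mulr_sumr; apply: eq_bigr => i _; rewrite mulrCA.
Qed.

HB.instance Definition _ :=
  GRing.Lalgebra_isAlgebra.Build K (ncps K X) nc_scaleAr.

Lemma nc_addE f g w : (f + g) w = f w + g w. Proof. by []. Qed.
Lemma nc_oppE f w : (- f) w = - f w. Proof. by []. Qed.
Lemma nc_zeroE w : (0 : ncps K X) w = 0. Proof. by []. Qed.
Lemma nc_scaleE a f w : (a *: f) w = a * f w. Proof. by []. Qed.
Lemma nc_oneE w : (1 : ncps K X) w = (nilp w)%:R. Proof. by []. Qed.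
Lemma nc_mulE f g w :
  (f * g) w = \sum_(0 <= i < (size w).+1) f (take i w) * g (drop i w).
Proof. by []. Qed.
Lemma nc_mul_nil f g : (f * g) [::] = f [::] * g [::].
Proof. by rewrite nc_mulE big_nat1. Qed.

(* The coefficients of the inverse of f are determined by recursion on the
   length of the word (k is fuel) as soon as f [::] != 0. *)
Fixpoint nc_inv_rec f (k : nat) (w : seq X) : K :=
  if k is k'.+1 then
    if nilp w then (f [::])^-1 else
    - (f [::])^-1 *
      \sum_(0 <= i < size w) f (take i.+1 w) * nc_inv_rec f k' (drop i.+1 w)
  else 0.

Definition nc_unit : pred (ncps K X) := fun f => f [::] != 0.
Definition nc_inv f : ncps K X :=
  if nc_unit f then fun w => nc_inv_rec f (size w).+1 w else f.

Lemma nc_inv_rec_fuel f k l w : (size w < k)%N -> (size w < l)%N ->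
  nc_inv_rec f k w = nc_inv_rec f l w.
Proof.
elim: k l w => [//|k IH] [//|l] [//|x w] /= hk hl.
congr (_ * _); apply: eq_big_nat => i /andP[_ hi]; congr (_ * _).
by apply: IH; rewrite size_drop; apply: leq_ltn_trans (leq_subr _ _) _.
Qed.

Lemma nc_mulrV f : nc_unit f -> f * nc_inv f = 1.
Proof.
move=> uf; apply: funext => w; rewrite nc_mulE nc_oneE /nc_inv uf.
case: w => [|x w]; first by rewrite big_nat1 /= mulfV.
rewrite big_nat_recl // take0 drop0 [nc_inv_rec _ _ (x :: w)]/=.
rewrite mulrA mulrN mulfV // mulN1r; apply/eqP; rewrite addrC subr_eq0.
apply/eqP/eq_big_nat => i /andP[_ hi]; congr (_ * _).
by rewrite (@nc_inv_rec_fuel _ _ (size w).+1) //= size_drop ltnS leq_subr.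
Qed.

Lemma nc_mulVr : {in nc_unit, left_inverse 1 nc_inv *%R}.
Proof.
move=> f uf; have fg := nc_mulrV uf.
have ug : nc_unit (nc_inv f).
  by rewrite /nc_inv ifT // /nc_unit /= invr_eq0.
have gh := nc_mulrV ug.
have e : f = nc_inv (nc_inv f) by rewrite -[LHS]mulr1 -gh mulrA fg mul1r.
by rewrite [X in _ * X]e.
Qed.

Fact nc_unitP f g : g * f = 1 /\ f * g = 1 -> nc_unit f.
Proof.
case=> _ /(congr1 (fun h : ncps K X => h [::])); rewrite nc_mul_nil => e.
by apply/eqP => f0; move/eqP: e; rewrite f0 mul0r eq_sym oner_eq0.
Qed.

Fact nc_inv_out : {in [predC nc_unit], nc_inv =1 id}.
Proof. by move=> f /negbTE nuf; rewrite /nc_inv ifF. Qed.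

HB.instance Definition _ := GRing.NzRing_hasMulInverse.Build (ncps K X)
  nc_mulVr nc_mulrV nc_unitP nc_inv_out.

Lemma nc_unitE f : (f \is a GRing.unit) = (f [::] != 0).
Proof. by []. Qed.

Definition two_sided_ideal (I : ncps K X -> Prop) : Prop :=
  [/\ I 0, forall f g, I f -> I g -> I (f + g)
         & forall f g h, I g -> I (f * g * h)].

(* Closedness for coefficientwise convergence, K being discrete. *)
Definition nc_closed (I : ncps K X -> Prop) : Prop :=
  forall f,
    (forall d : nat, exists2 g, I g & forall w, (size w < d)%N -> g w = f w) ->
    I f.

Definition closed_ideal (S : ncps K X -> Prop) : ncps K X -> Prop :=
  fun f => forall I, two_sided_ideal I -> nc_closed I ->
    (forall g, S g -> I g) -> I f.

End Ring.

Definition letter (K : fieldType) (X : eqType) (x : X) : ncps K X :=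
  fun w => (w == [:: x])%:R.

Definition inversions (m : nat) (nu : seq 'I_m) :
    {set 'I_(size nu) * 'I_(size nu)} :=
  [set p : 'I_(size nu) * 'I_(size nu) | (p.1 < p.2)%N &&
           (tnth (in_tuple nu) p.2 < tnth (in_tuple nu) p.1)%N].

Definition inv (m : nat) (nu : seq 'I_m) : nat := #|inversions nu|.

Section QDeterminant.
Variables (K : fieldType) (m : nat) (q : 'I_m -> 'I_m -> K).

(* The label i in 1..m is the ordinal of value i - 1.  Only the values q i j
   with i < j are ever used. *)
Definition weight (lambda mu : seq 'I_m) : K :=
  (\prod_(p in inversions mu)
     q (tnth (in_tuple mu) p.2) (tnth (in_tuple mu) p.1)) *
  (\prod_(p in inversions lambda)
     (q (tnth (in_tuple lambda) p.2) (tnth (in_tuple lambda) p.1))^-1).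

(* The letter (i, j) stands for a_ij, so the word a_{lambda,mu} is
   zip lambda mu. *)
Local Notation series := (ncps K ('I_m * 'I_m)%type).

Definition genA : 'M[series]_m := \matrix_(i, j) letter K (i, j).

(* Each g stands for the defining relation g = 0 of a q-Cartier-Foata matrix. *)
Inductive qCF_relation : series -> Prop :=
| qCF_lt (i j k l : 'I_m) : (i < j)%N -> (k < l)%N ->
    qCF_relation (q k l *: (genA j l * genA i k)
                  - q i j *: (genA i k * genA j l))
| qCF_gt (i j k l : 'I_m) : (i < j)%N -> (l < k)%N ->
    qCF_relation (genA j l * genA i k
                  - (q i j * q l k) *: (genA i k * genA j l))
| qCF_eq (i j k : 'I_m) : (i < j)%N ->
    qCF_relation (genA j k * genA i k - q i j *: (genA i k * genA j k)).

(* Equality in the quotient by the closed two-sided ideal of the relations. *)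
Definition qCF_eqmod (f g : series) : Prop := closed_ideal qCF_relation (f - g).

(* Multiplies each word a_{lambda,mu} of f by weight lambda mu. *)
Definition reweight (f : series) : series :=
  fun u => weight (unzip1 u) (unzip2 u) * f u.

(* The entry in the row labelled rho and the column labelled kappa is meant to
   be a linear combination of 1 and a_{rho,kappa}: the labels are then carried
   by the letters themselves.  The product is ordered by columns. *)
Definition detq (N : nat) (B : 'M[series]_N) : series :=
  reweight (\sum_(s : 'S_N)
    (-1) ^+ inv [seq s r | r <- enum 'I_N] * \prod_(r < N) B (s r) r).

Section Sylvester.
Variables (n : nat) (hnm : (n < m)%N).

Let emb : 'I_n -> 'I_m := widen_ord (ltnW hnm).

Definition genA0 : 'M[series]_n := mxsub emb emb genA.

Definition bordered (i j : 'I_m) : 'M[series]_(n + 1) :=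
  block_mx (1%:M - genA0)                    (- \col_(r < n) genA (emb r) j)
           (- \row_(s < n) genA i (emb s))   (- (genA i j)%:M).

(* Only used for i, j >= n. *)
Definition cq (i j : 'I_m) : series :=
  - ((detq (1%:M - genA0))^-1 * detq (bordered i j)).

End Sylvester.

(* det_q(I - C) for C = (c i j) with i, j >= n.  enum J lists J increasingly,
   and S_J is the set of permutations fixing the complement of J. *)
Definition detq_IC (n : nat) (c : 'I_m -> 'I_m -> series) : series :=
  \sum_(J : {set 'I_m} | J \subset [set j : 'I_m | (n <= j)%N])
    (-1) ^+ #|J| *
    \sum_(s : {perm 'I_m} | perm_on J s)
      ((-1) ^+ inv [seq s j | j <- enum J]
        * weight [seq s j | j <- enum J] (enum J))
      *: \prod_(j <- enum J) c (s j) j.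

Lemma weight_nil : weight [::] [::] = 1.
Proof.
by rewrite /weight !big_pred0 ?mulr1 // => -[[i hi] ?].
Qed.

Lemma detq_genA0_unit n (hnm : (n < m)%N) :
  detq (1%:M - genA0 hnm) \is a GRing.unit.
Proof.
have nilX N (F : 'I_N -> series) :
    (\prod_(r < N) F r) [::] = \prod_(r < N) F r [::].
  by apply: (big_morph (fun f : series => f [::])) => // f g; exact: nc_mul_nil.
have nilS (s : 'S_n) :
    (\prod_(r < n) (1%:M - genA0 hnm) (s r) r) [::] = (s == 1%g)%:R.
  rewrite nilX; have [->|s1] := eqVneq s 1%g.
    by apply: big1 => r _; rewrite perm1 !mxE eqxx nc_addE nc_oppE subr0.
  have [r sr] : exists r, s r != r.
    apply/existsP; apply: contraNT s1 => /existsPn h.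
    by apply/eqP/permP => r; rewrite perm1; apply/eqP; have := h r; case: eqP.
  rewrite (bigD1 r) //= !mxE (negbTE sr) nc_addE nc_oppE subr0.
  by rewrite mulr0n nc_zeroE mul0r.
have nilsum (F : 'S_n -> series) : (\sum_s F s) [::] = \sum_s F s [::].
  exact: (big_morph (fun f : series => f [::])).
rewrite nc_unitE /detq /reweight weight_nil mul1r nilsum (bigD1 (1%g : 'S_n)) //=.
rewrite nc_mul_nil nilS eqxx mulr1 big1 => [|s s1]; last first.
  by rewrite nc_mul_nil nilS (negbTE s1) mulr0.
rewrite addr0; elim: (inv _) => [|k]; first by rewrite expr0 oner_eq0.
by rewrite exprS nc_mul_nil nc_oppE mulN1r oppr_eq0.
Qed.

End QDeterminant.

(* Main.v *)
(* Multiplying each word by its weight turns the q-identity into the one with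
   all q equal to 1: the weight of a product of words is the product of the
   weights times a bicharacter of the labels, which is trivial or a scalar on the
   balanced words that occur, and reweighting maps the ideal of the commutation
   relations (entries in different rows commute) into that of the q-relations.
   For commuting rows the column-ordered determinant does not change when right
   multiples of earlier columns are added to a column, so the columns of
   (I - A_0)^-1 A_12 clear the upper right block of I - A, and
   det(I - A) = det(I - A_0) det(I - C), where C is the Schur complement; the
   same step on the bordered matrix identifies the entries of C. *)
From mathcomp Require Import all_boot all_order all_algebra all_fingroup.
From mathcomp Require Import zify ring.
From mathcomp Require Import boolp reals.
Require Import Defs.

Set Implicit Arguments.
Unset Strict Implicit.
Unset Printing Implicit Defensive.

Import GRing.Theory.
Local Open Scope ring_scope.

(** Call the labels of A_0 low and the others high. A word of c_ij has as row labels i and a low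
    multiset, as column labels j and the same low multiset. By the block condition on [q], a high
    label standing before a low one always contributes the same parameter, so the low parts cancel
    between rows and columns, and the high labels leave precisely the weight that det_q(I - C)
    attaches to a product of entries. The obstacle on the side of the ideal is that [reweight] is
    not multiplicative, so the series it sends into the ideal of the q-relations need not visibly
    form an ideal. [twisted_ideal] therefore asks for all multiples by words, and closedness carries
    this over to multiples by series. No quotient ring is formed: inverses are taken in the free
    series algebra, and determinants are compared through a congruence. *)

(** * Congruences on a ring *)

Record ring_congruence (R : pzRingType) (E : R -> R -> Prop) : Prop := {
  cong_refl : forall x, E x x;
  cong_sym : forall x y, E x y -> E y x;
  cong_trans : forall x y z, E x y -> E y z -> E x z;
  cong_add : forall x x' y y', E x x' -> E y y' -> E (x + y) (x' + y');
  cong_mul : forall x x' y y', E x x' -> E y y' -> E (x * y) (x' * y') }.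

Section Congruence.
Variables (R : pzRingType) (E : R -> R -> Prop).
Hypothesis cE : ring_congruence E.

Lemma cong_opp x y : E x y -> E (- x) (- y).
Proof.
by rewrite -(mulN1r x) -(mulN1r y); apply: (cong_mul cE (cong_refl cE _)).
Qed.

Lemma cong_sum (I : Type) (r : seq I) (P : pred I) (F G : I -> R) :
  (forall i, P i -> E (F i) (G i)) ->
  E (\sum_(i <- r | P i) F i) (\sum_(i <- r | P i) G i).
Proof.
move=> FG; apply: big_ind2 => // [|x x' y y']; first exact: (cong_refl cE).
exact: (cong_add cE).
Qed.

Lemma cong_prod (I : eqType) (r : seq I) (F G : I -> R) :
  {in r, forall i, E (F i) (G i)} ->
  E (\prod_(i <- r) F i) (\prod_(i <- r) G i).
Proof.
move=> FG; rewrite big_seq [X in E _ X]big_seq.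
apply: big_ind2 => // [|x x' y y']; first exact: (cong_refl cE).
exact: (cong_mul cE).
Qed.

(** Induction on [r]: the head [x] is carried past [t1], the factors that precede it in [t]. *)
Lemma cong_prod_perm (I : eqType) (f : I -> R) (r t : seq I) :
  uniq r -> perm_eq r t ->
  {in r &, forall x y, x != y -> E (f x * f y) (f y * f x)} ->
  E (\prod_(x <- r) f x) (\prod_(x <- t) f x).
Proof.
elim: r t => [|x r IH] t /= => [_|/andP[xr ur]] rt fC.
  by move: rt; rewrite perm_sym => /perm_nilP ->; exact: (cong_refl cE).
have xt : x \in t by rewrite -(perm_mem rt) mem_head.
case/splitPr: t / xt rt => t1 t2; rewrite -cat_rcons -cats1 -catA => rt.
have {}rt : perm_eq r (t1 ++ t2).
  by rewrite -(perm_cons x) (perm_trans rt) // perm_catCA.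
have mt y : y \in t1 -> y \in r by move=> yt; rewrite (perm_mem rt) mem_cat yt.
rewrite big_cons !big_cat /= big_seq1 !mulrA.
have step : E (f x * \prod_(y <- t1) f y) ((\prod_(y <- t1) f y) * f x).
  elim: t1 mt {rt} => [|y t1 IHt] mt.
    by rewrite big_nil mulr1 mul1r; exact: (cong_refl cE).
  have yr : y \in r by apply: mt; rewrite mem_head.
  rewrite big_cons mulrA; apply: (cong_trans cE (y := f y * f x * _)).
    apply: (cong_mul cE) (cong_refl cE _); apply: fC.
    - by rewrite mem_head.
    - by rewrite inE yr orbT.
    - by apply: contraNneq xr => ->.
  rewrite -!mulrA; apply: (cong_mul cE (cong_refl cE _)); apply: IHt => z zt.
  by apply: mt; rewrite inE zt orbT.
apply: (cong_trans cE) (cong_mul cE step (cong_refl cE _)).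
rewrite -mulrA; apply: (cong_mul cE (cong_refl cE _)); rewrite -big_cat /=.
by apply: IH => // y z yr zr; apply: fC; rewrite inE ?yr ?zr orbT.
Qed.

End Congruence.

(** * Column-ordered determinants over a non-commutative ring *)

(** The entries are a function on all of [nat], so that leading blocks, shifted blocks and minors
    arise by reindexing, without casts between ordinal types. *)
Definition coldet (R : pzRingType) N (F : nat -> nat -> R) : R :=
  \sum_(s : 'S_N) (-1) ^+ s * \prod_(r < N) F (s r) r.

Section ColDet.
Variable R : pzRingType.
Implicit Types F G H : nat -> nat -> R.

Lemma eq_coldet N F G :
  (forall i j, (i < N)%N -> (j < N)%N -> F i j = G i j) ->
  coldet N F = coldet N G.
Proof.
by move=> FG; apply: eq_bigr => s _; congr (_ * _); apply: eq_bigr => r _; apply: FG.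
Qed.

Lemma coldet0 F : coldet 0 F = 1.
Proof.
have S0 (s : 'S_0) : s = 1%g by apply/permP => -[].
rewrite /coldet (bigD1 1%g) //= big_ord0 odd_perm1 mulr1 big1 ?addr0 // => s.
by rewrite (S0 s) eqxx.
Qed.

Lemma lift_perm_max_bij N :
  bijective (fun p : 'I_N.+1 * 'S_N => lift_perm ord_max p.1 p.2).
Proof.
apply: inj_card_bij => [[i s] [j t] /= /permP st|]; last first.
  by rewrite card_prod !card_Sn card_ord factS.
have ij : i = j by have := st ord_max; rewrite !lift_perm_id.
congr pair => //; apply/permP => k; have := st (lift ord_max k).
by rewrite !lift_perm_lift ij => /lift_inj.
Qed.

(* Laplace expansion along the last column; it must be the last one (or the
   first) because products are ordered by columns. *)
Lemma coldet_recr N F : coldet N.+1 F =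
  \sum_(i < N.+1) (-1) ^+ (N + i) * coldet N (fun r c => F (bump i r) c) * F i N.
Proof.
rewrite /coldet (reindex _ (onW_bij _ (lift_perm_max_bij N))) /=.
rewrite -(pair_big xpredT xpredT (fun (i : 'I_N.+1) (t : 'S_N) =>
  (-1) ^+ lift_perm ord_max i t *
    \prod_(r < N.+1) F (lift_perm ord_max i t r) r)) /=.
apply: eq_bigr => i _; rewrite mulr_sumr mulr_suml; apply: eq_bigr => t _.
rewrite big_ord_recr /= lift_perm_id !mulrA; congr (_ * _ * _).
  by rewrite odd_lift_perm !signr_addb exprD !signr_odd.
apply: eq_bigr => r _.
have -> : widen_ord (leqnSn N) r = lift ord_max r.
  by apply: val_inj; rewrite /= /bump leqNgt ltn_ord add0n.
by rewrite lift_perm_lift.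
Qed.

(** Induction on [k] by expansion along the last column: its upper [n] entries vanish, and deleting
    a lower row leaves the upper left block intact. *)
Lemma coldet_block n k F :
  (forall i j, (i < n)%N -> (n <= j)%N -> F i j = 0) ->
  coldet (n + k) F = coldet n F * coldet k (fun i j => F (n + i)%N (n + j)%N).
Proof.
elim: k F => [|k IH] F F0; first by rewrite addn0 coldet0 mulr1.
rewrite addnS !coldet_recr -addnS big_split_ord /= big1 ?add0r => [|i _]; last first.
  by rewrite F0 ?mulr0 // leq_addr.
rewrite mulr_sumr; apply: eq_bigr => i _.
have bumpn r : (r < n)%N -> bump (n + i) r = r by rewrite /bump; lia.
rewrite IH => [|r c rn nc]; last by rewrite bumpn ?F0.
rewrite (eq_coldet (G := F)) => [|r c rn _]; last by rewrite bumpn.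
have -> : coldet k (fun r c => F (bump (n + i) (n + r)) (n + c)%N)
        = coldet k (fun r c => F (n + bump i r)%N (n + c)%N).
  by apply: eq_coldet => r c _ _; rewrite bumpDl.
rewrite !mulrA; congr (_ * _ * _).
have -> : (-1) ^+ (n + k + (n + i)) = (-1) ^+ (k + i) :> R.
  by rewrite -signr_odd -[RHS]signr_odd; congr (_ ^+ nat_of_bool _); lia.
by rewrite commr_sign.
Qed.

Lemma coldet_col_add N k F G H : (k < N)%N ->
  (forall i j, j != k -> F i j = G i j) ->
  (forall i j, j != k -> F i j = H i j) ->
  (forall i, F i k = G i k + H i k) ->
  coldet N F = coldet N G + coldet N H.
Proof.
move=> kN FG FH Fk; rewrite /coldet -big_split /=; apply: eq_bigr => s _.
rewrite -mulrDr; congr (_ * _).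
have lin (r : seq 'I_N) : uniq r -> Ordinal kN \in r ->
    \prod_(j <- r) F (s j) j
    = \prod_(j <- r) G (s j) j + \prod_(j <- r) H (s j) j.
  elim: r => // j r IH /= /andP[jr ur]; rewrite inE eq_sym !big_cons.
  have neq_k l : l != Ordinal kN -> val l != k.
    by apply: contra_neq => e; apply: val_inj.
  have [jk|jk /= kr] := eqVneq j (Ordinal kN).
    have GH : {in r, forall l, val l != k}.
      by move=> l lr; apply: neq_k; apply: contraNneq jr => lk; rewrite jk -lk.
    move=> _; rewrite jk /= Fk mulrDl; congr (_ * _ + _ * _); rewrite !big_seq.
      by apply: eq_bigr => l /GH; exact: FG.
    by apply: eq_bigr => l /GH; exact: FH.
  have {}jk := neq_k _ jk.
  by rewrite (IH ur kr) mulrDr {1}(FG _ _ jk) (FH _ _ jk).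
by apply: lin; rewrite ?index_enum_uniq ?mem_index_enum.
Qed.

End ColDet.

(** * Column operations modulo a congruence *)

Section ColumnOperations.
Variables (R : pzRingType) (E : R -> R -> Prop).
Hypothesis cE : ring_congruence E.
Implicit Types F X : nat -> nat -> R.

Let E0 := cong_refl cE.

(* Only the columns left of k must commute: the factor x stands right of the
   entries that are exchanged. *)
Lemma coldet_col_mulr_eq0 N F i k x : (i < k)%N -> (k < N)%N ->
  (forall r, F r k = F r i * x) ->
  (forall r r' c c', (r < N)%N -> (r' < N)%N -> r != r' ->
     (c < k)%N -> (c' < k)%N -> E (F r c * F r' c') (F r' c' * F r c)) ->
  E (coldet N F) 0.
Proof.
move=> ik kN Fk FC; have iN : (i < N)%N by apply: ltn_trans kN.
pose pn (s : 'S_N) r := if insub r is Some r' then val (s r') else r.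
have pnE s r (rN : (r < N)%N) : pn s r = s (Ordinal rN) by rewrite /pn insubT.
(* Column [k] is column [i] times [x]; with [x] pulled out, the entries to its left in [f s] all
   come from columns before [k], the only ones that may be exchanged. *)
pose g s r := F (pn s r) (if r == k then i else r).
pose f s := (\prod_(0 <= r < k.+1) g s r) * x
             * \prod_(k.+1 <= r < N) F (pn s r) r.
have fE (s : 'S_N) : \prod_(r < N) F (s r) r = f s.
  rewrite (eq_bigr (fun r : 'I_N => F (pn s r) r)) => [|r _]; last first.
    by rewrite (pnE _ _ (ltn_ord r)); congr (F (s _) _); exact: val_inj.
  rewrite -(big_mkord xpredT (fun r => F (pn s r) r)).
  rewrite (@big_cat_nat _ _ _ k.+1) //= /f; congr (_ * _).
  rewrite !big_nat_recr //= -mulrA /g eqxx Fk; congr (_ * _).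
  by apply: eq_big_nat => r rk; rewrite ifN //; lia.
(* Composing with [t] exchanges the rows assigned to columns [i] and [k]. Both positions read column
   [i], so the factors left of [x] are merely permuted. *)
pose t : 'S_N := tperm (Ordinal iN) (Ordinal kN).
pose tn r := if r == i then k else if r == k then i else r.
have tnN r : (r < N)%N -> (tn r < N)%N.
  by rewrite /tn; case: ifP => // _; case: ifP.
have pnt s r : (r < N)%N -> pn (t * s)%g r = pn s (tn r).
  move=> rN; rewrite (pnE _ _ rN) (pnE _ _ (tnN _ rN)) permM; congr (val (s _)).
  apply: val_inj; rewrite /t /= permE /= /tn -!val_eqE /=.
  by case: ifP => // _; case: ifP.
have fC s : E (f (t * s)%g) (f s).
  rewrite /f; apply: (cong_mul cE); last first.
    rewrite (eq_big_nat _ _ (F2 := fun r => F (pn s r) r)) // => r rk.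
    by rewrite pnt; [rewrite /tn !ifN //; lia | lia].
  apply: (cong_mul cE) => //.
  rewrite (eq_big_nat _ _ (F2 := fun r => g s (tn r))) => [|r rk]; last first.
    rewrite /g pnt; last by lia.
    congr F; rewrite /tn; case: (eqVneq r i) => [->|ri].
      by rewrite eqxx if_same.
    by case: (eqVneq r k) => [_|/negbTE ->] //; rewrite if_same.
  rewrite -(big_map tn xpredT).
  have tnK : involutive tn.
    move=> r; rewrite /tn; case: (eqVneq r i) => [->|ri].
      by rewrite eqxx ifN //; lia.
    case: (eqVneq r k) => [->|rk]; first by rewrite eqxx.
    by rewrite !ifN.
  have tn_le r : (tn r < k.+1)%N = (r < k.+1)%N.
    rewrite /tn; case: (eqVneq r i) => [->|ri]; first by lia.
    by case: (eqVneq r k) => [->|rk] //; lia.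
  apply: (cong_prod_perm cE).
  - by rewrite map_inj_uniq ?iota_uniq //; apply: inv_inj.
  - apply: uniq_perm; rewrite ?map_inj_uniq ?iota_uniq //; first exact: inv_inj.
    move=> r; rewrite -[r]tnK mem_map; last exact: inv_inj.
    by rewrite !mem_index_iota /= !tn_le.
  - have mem r : r \in [seq tn i | i <- index_iota 0 k.+1] -> (r < k.+1)%N.
      by case/mapP => r' + ->; rewrite mem_index_iota tn_le.
    move=> r r' /mem rk /mem rk' rr'; have rN : (r < N)%N by lia.
    have rN' : (r' < N)%N by lia.
    rewrite /g (pnE _ _ rN) (pnE _ _ rN'); apply: FC => //.
    + apply: contra_neq rr' => /val_inj /perm_inj.
      by move/(congr1 val).
    + by case: eqP; lia.
    + by case: eqP; lia.
have odd_t (s : 'S_N) : odd_perm (t * s)%g = ~~ odd_perm s.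
  by rewrite odd_mul_tperm -val_eqE /= ltn_eqF.
(* Multiplication by [t] pairs odd with even permutations, whose congruent products cancel. *)
rewrite /coldet (bigID (@odd_perm _)) /= (reindex_inj (mulgI t)) /=.
rewrite (eq_bigl (fun s : 'S_N => ~~ odd_perm s) _ odd_t) -big_split /=.
have sum0 : \sum_(s : 'S_N | ~~ odd_perm s) (0 : R) = 0 by rewrite big1_eq.
rewrite -[X in E _ X]sum0.
apply: (cong_sum cE) => s /negbTE se.
rewrite odd_t se expr0 expr1 mul1r mulN1r !fE addrC.
rewrite -(subrr (f s)); apply: (cong_add cE) => //; exact: (cong_opp cE).
Qed.

(** The columns are modified from the last to the first: while column [k] is treated, those left of
    it are still columns of [F], whose entries in different rows commute. *)
Lemma coldet_colop N F X :
  (forall r r' c c', (r < N)%N -> (r' < N)%N -> r != r' ->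
     (c < N)%N -> (c' < N)%N -> E (F r c * F r' c') (F r' c' * F r c)) ->
  E (coldet N (fun i j => F i j + \sum_(0 <= l < j) F i l * X l j))
    (coldet N F).
Proof.
move=> FC.
(* Columns beyond k are already modified, column k has received p terms. *)
pose H k p i j := if (j < k)%N then F i j else
  F i j + \sum_(0 <= l < if j == k then p else j) F i l * X l j.
have H0 k : coldet N (H k.+1 k.+1) = coldet N (H k 0).
  apply: eq_coldet => i j _ _; rewrite /H ltnS.
  case: (ltngtP j k) => [//|jk|->]; last by rewrite big_geq ?addr0.
  by case: eqP => [->|].
have step k : (k < N)%N -> forall p, (p <= k)%N ->
    E (coldet N (H k p)) (coldet N (H k 0)).
  move=> kN; elim=> [//|p IH] pk.
  have -> : coldet N (H k p.+1) = coldet N (H k p)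
      + coldet N (fun i j => if j == k then F i p * X p k else H k p i j).
    apply: (coldet_col_add (k := k)) => // [i j|i j|i]; rewrite /H.
    - by move/negbTE ->.
    - by move/negbTE ->.
    - by rewrite ltnn eqxx big_nat_recr //= addrA.
  rewrite -[X in E _ X]addr0; apply: (cong_add cE); first by apply: IH; lia.
  apply: (coldet_col_mulr_eq0 (i := p) (k := k) (x := X p k)) => // [r|].
    by rewrite eqxx /H pk ltn_eqF.
  move=> r r' c c' rN rN' rr' ck ck'.
  by rewrite /H !ltn_eqF // ck ck'; apply: FC => //; lia.
have main d k : (k + d = N)%N -> E (coldet N (H k k)) (coldet N F).
  elim: d k => [|d IH] k kd.
    rewrite (eq_coldet (G := F)) // => i j _ jN.
    by rewrite /H ifT //; lia.
  have kN : (k < N)%N by lia.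
  apply: (cong_trans cE (step k kN k (leqnn k))).
  by rewrite -H0; apply: IH; lia.
apply: (cong_trans cE) (main N 0%N _) => //.
rewrite [X in E X _](eq_coldet (G := H 0%N 0%N)) // => i j _ _.
by rewrite /H ltn0; case: eqP => [->|].
Qed.

Lemma coldet_schur n k F X :
  (forall r r' c c', (r < n + k)%N -> (r' < n + k)%N -> r != r' ->
     (c < n + k)%N -> (c' < n + k)%N -> E (F r c * F r' c') (F r' c' * F r c)) ->
  (forall i j, (i < n)%N -> (n <= j)%N ->
     F i j + \sum_(0 <= l < n) F i l * X l j = 0) ->
  E (coldet (n + k) F)
    (coldet n F * coldet k (fun i j => F (n + i)%N (n + j)%N
       + \sum_(0 <= l < n) F (n + i)%N l * X l (n + j)%N)).
Proof.
move=> FC F0.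
(* Truncated to the upper right block, so that the operation leaves the first [n] columns alone and
   adds only multiples of these to the others. *)
pose X' l j := if (l < n)%N && (n <= j)%N then X l j else 0.
have sumX' i j : \sum_(0 <= l < j) F i l * X' l j
    = if (n <= j)%N then \sum_(0 <= l < n) F i l * X l j else 0.
  have [nj|jn] := leqP n j; last first.
    by rewrite big1 // => l _; rewrite /X' [(n <= j)%N]leqNgt jn andbF mulr0.
  rewrite (@big_cat_nat _ _ _ n) //= [X in _ + X]big_nat [X in _ + X]big1 ?addr0.
    by apply: eq_big_nat => l ln; rewrite /X' nj ifT //; lia.
  by move=> l ln; rewrite /X' ifN ?mulr0 //; lia.
apply: (cong_trans cE (cong_sym cE (coldet_colop X' FC))).
rewrite coldet_block => [|i j ni nj]; last by rewrite sumX' nj F0.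
rewrite (eq_coldet (G := F)) => [|i j _ jn]; last first.
  by rewrite sumX' ifN ?addr0 // -ltnNge.
rewrite (eq_coldet (N := k) (G := fun i j => F (n + i)%N (n + j)%N
       + \sum_(0 <= l < n) F (n + i)%N l * X l (n + j)%N)) // => i j _ _.
by rewrite sumX' leq_addr.
Qed.

End ColumnOperations.

(** * Products over pairs of positions; signs and inversions *)

Section PairsProd.
Variable K : comPzRingType.

(** Both the weight factors and the sign [(-1) ^+ inv u] are products over pairs of positions s < t;
    the recursive form gives them by induction on the word. *)
Fixpoint pairs_prod (T : Type) (g : T -> T -> K) (u : seq T) : K :=
  if u is x :: v then (\prod_(y <- v) g x y) * pairs_prod g v else 1.

Lemma pairs_prod_map (S T : Type) (f : S -> T) (g : T -> T -> K) (u : seq S) :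
  pairs_prod g (map f u) = pairs_prod (fun x y => g (f x) (f y)) u.
Proof. by elim: u => //= x u ->; rewrite big_map. Qed.

Lemma pairs_prod_tnth (T : Type) (g : T -> T -> K) (u : seq T) :
  \prod_(s < size u) \prod_(t < size u | (s < t)%N)
     g (tnth (in_tuple u) s) (tnth (in_tuple u) t) = pairs_prod g u.
Proof.
elim: u => [|x u IH]; first by rewrite big_ord0.
rewrite /= big_ord_recl; congr (_ * _).
  rewrite big_mkcond big_ord_recl /= mul1r (big_tnth _ _ u).
  apply: eq_bigr => t _; congr g; rewrite !(tnth_nth x) //=.
rewrite -IH; apply: eq_bigr => s _.
rewrite big_mkcond big_ord_recl /= mul1r [RHS]big_mkcond.
apply: eq_bigr => t _.
by rewrite !(tnth_nth x) /=.
Qed.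

(** On an increasing word, order of positions is order of values; this form can be compared with a
    Vandermonde product. *)
Lemma pairs_prod_sorted m (g : 'I_m -> 'I_m -> K) (u : seq 'I_m) :
  sorted (fun i j : 'I_m => (i < j)%N) u ->
  pairs_prod g u = \prod_(x <- u) \prod_(y <- u | (x < y)%N) g x y.
Proof.
have tr : transitive (fun i j : 'I_m => (i < j)%N) by move=> ? ? ?; apply: ltn_trans.
elim: u => [|x u IH] /=; first by rewrite big_nil.
move=> xu; rewrite big_cons big_cons ltnn; have /allP xlt := order_path_min tr xu.
congr (_ * _).
  by rewrite big_seq [RHS]big_seq_cond; apply: eq_bigl => y; case yu: (y \in u) => //=; rewrite xlt.
rewrite IH ?(path_sorted xu) // big_seq [RHS]big_seq; apply: eq_bigr => y /xlt xy.
by rewrite big_cons ltnNge ltnW.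
Qed.

Lemma inversions_prod m (h : 'I_m -> 'I_m -> K) (u : seq 'I_m) :
  \prod_(p in inversions u) h (tnth (in_tuple u) p.2) (tnth (in_tuple u) p.1)
  = pairs_prod (fun x y : 'I_m => if (y < x)%N then h y x else 1) u.
Proof.
rewrite -pairs_prod_tnth (pair_big_dep xpredT
  (fun s t : 'I_(size u) => (s < t)%N)) /=.
rewrite -big_mkcondr /=; apply: eq_bigl => -[s t] /=.
by rewrite inE.
Qed.

End PairsProd.

Lemma sign_inv m (u : seq 'I_m) (K : comPzRingType) :
  (-1) ^+ inv u = pairs_prod (fun x y : 'I_m => if (y < x)%N then -1 else 1) u :> K.
Proof. by rewrite -(inversions_prod (fun _ _ => -1)) prodr_const. Qed.

Lemma sorted_enum_ord m (J : {set 'I_m}) :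
  sorted (fun i j : 'I_m => (i < j)%N) (enum J).
Proof.
rewrite {1}/enum_mem -enumT; apply: sorted_filter.
  by move=> ? ? ?; apply: ltn_trans.
by rewrite -(sorted_map (f := val) (e' := ltn)) val_enum_ord iota_ltn_sorted.
Qed.

(* Outside J the key j |-> m + j exceeds all keys from J, so that the pairs
   meeting the complement of J contribute equally to both sides of the
   Vandermonde identity. *)
Lemma sign_inv_perm_on m (J : {set 'I_m}) (s : 'S_m) (R : pzRingType) :
  perm_on J s -> (-1) ^+ inv [seq s j | j <- enum J] = (-1) ^+ s :> R.
Proof.
move=> Js; pose kappa (j : 'I_m) : int := if j \in J then j%:Z else (m + j)%:Z.
pose a : 'rV[int]_m := \row_j kappa j.
have sJ j : (s j \in J) = (j \in J) := perm_closed j Js.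
have sC j : j \notin J -> s j = j by move=> jJ; apply: out_perm Js jJ.
pose sg t := \prod_(i < m) \prod_(j < m | (i < j)%N)
  Num.sg (kappa ((t : 'S_m) j) - kappa (t i)).
have sgV (b : 'rV[int]_m) : Num.sg (\det (Vandermonde m b)) =
    \prod_(i < m) \prod_(j < m | (i < j)%N) Num.sg (b 0 j - b 0 i).
  rewrite det_Vandermonde (big_morph _ (@Num.Theory.sgrM _) (@Num.Theory.sgr1 _)).
  apply: eq_bigr => i _.
  by rewrite (big_morph _ (@Num.Theory.sgrM _) (@Num.Theory.sgr1 _)).
(* Permuting the nodes permutes the columns of the Vandermonde matrix, which multiplies its
   determinant by the signature. *)
have sg_s : sg s = (-1) ^+ s * sg 1%g.
  have -> : sg s = Num.sg (\det (Vandermonde m (col_perm s a))).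
    by rewrite sgV; apply: eq_bigr => i _; apply: eq_bigr => j _; rewrite !mxE.
  have -> : sg 1%g = Num.sg (\det (Vandermonde m a)).
    by rewrite sgV; apply: eq_bigr => i _; apply: eq_bigr => j _; rewrite !mxE !perm1.
  have -> : Vandermonde m (col_perm s a) = col_perm s (Vandermonde m a).
    by apply/matrixP => i j; rewrite !mxE.
  rewrite col_permE det_mulmx det_perm odd_permV Num.Theory.sgrM mulrC.
  by rewrite Num.Theory.sgrX Num.Theory.sgrN1.
have sgB (x y : nat) : Num.sg (x%:Z - y%:Z)
    = (if (y < x)%N then 1 else if (x < y)%N then -1 else 0) :> int.
  by case: (ltngtP x y) => xy; [rewrite Num.Theory.ltr0_sg | rewrite Num.Theory.gtr0_sg
    | rewrite xy subrr Num.Theory.sgr0] => //; lia.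
(* Second evaluation of [sg s], pair by pair: the sign changes exactly at the inversions inside
   [J]. *)
have sg_pair (i j : 'I_m) : (i < j)%N -> Num.sg (kappa (s j) - kappa (s i))
    = Num.sg (kappa j - kappa i) *
      (if [&& i \in J, j \in J & (s j < s i)%N] then -1 else 1).
  move=> ij; have sij : s i != s j :> nat.
    by apply: contraTneq ij => /val_inj /perm_inj ->; rewrite ltnn.
  rewrite /kappa !sJ; move: (ltn_ord i) (ltn_ord j) (ltn_ord (s i)) (ltn_ord (s j)).
  case: ifPn => jJ; case: ifPn => iJ; try rewrite (sC i iJ);
    try rewrite (sC j jJ); rewrite ?andbF !sgB /=;
    repeat (case: ltnP => ?); rewrite ?mulr1 ?mul1r //; lia.
have sg_inv : sg s = sg 1%g * (-1) ^+ inv [seq s j | j <- enum J].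
  rewrite sign_inv pairs_prod_map (pairs_prod_sorted _ (sorted_enum_ord J)).
  rewrite big_enum /= big_mkcond -big_split /=; apply: eq_bigr => k _.
  rewrite big_enum_cond /=.
  rewrite (eq_bigr _ (fun j => @sg_pair k j)) big_split /=.
  congr (_ * _); first by apply: eq_bigr => j _; rewrite !perm1.
  have [iJ|iJ] := boolP (k \in J); last by rewrite big1.
  rewrite big_mkcond [RHS]big_mkcond; apply: eq_bigr => j _ /=.
  by case: (j \in J); case: ltnP.
have sg1 : sg 1%g != 0.
  apply/prodf_neq0 => i _; apply/prodf_neq0 => j ij.
  rewrite !perm1 Num.Theory.sgr_eq0 /kappa; move: (ltn_ord i) (ltn_ord j).
  by case: ifP; case: ifP; lia.
move: sg_inv; rewrite sg_s mulrC => /(mulfI sg1) /esym.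
rewrite -signr_odd => /Num.Theory.signr_inj odd_inv.
by rewrite -signr_odd odd_inv.
Qed.

Lemma perm_eq_count_mem (T : eqType) (s t : seq T) :
  (forall x, count_mem x s = count_mem x t) -> perm_eq s t.
Proof. by move=> st; apply/allP => x _ /=; rewrite st. Qed.

(** * Weights and their bicharacter *)

Section Weight.
Variables (K : fieldType) (m : nat) (q : 'I_m -> 'I_m -> K).
Implicit Types a b u v : seq 'I_m.

Let qinv (x y : 'I_m) : K := if (y < x)%N then q y x else 1.

Definition inv_weight u : K := pairs_prod qinv u.

(** The contribution of the inversions between two concatenated words: the bicharacter that measures
    how far weights are from being multiplicative. *)
Definition cross_weight u v : K := \prod_(x <- u) \prod_(y <- v) qinv x y.

Lemma weightE u v : weight q u v = inv_weight v / inv_weight u.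
Proof.
by rewrite /weight (inversions_prod q) prodfV (inversions_prod q).
Qed.

Lemma inv_weight_cat u v :
  inv_weight (u ++ v) = inv_weight u * inv_weight v * cross_weight u v.
Proof.
rewrite /inv_weight /cross_weight; elim: u => [|x u IH] /=.
  by rewrite big_nil mul1r mulr1.
by rewrite IH big_cons big_cat /=; ring.
Qed.

Lemma weight_cat u u' v v' : weight q (u ++ u') (v ++ v') =
  weight q u v * weight q u' v' * (cross_weight v v' / cross_weight u u').
Proof. by rewrite !weightE !inv_weight_cat !invfM; ring. Qed.

Lemma cross_weight_catl u u' v :
  cross_weight (u ++ u') v = cross_weight u v * cross_weight u' v.
Proof. exact: big_cat. Qed.

Lemma cross_weight_catr u v v' :
  cross_weight u (v ++ v') = cross_weight u v * cross_weight u v'.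
Proof.
by rewrite /cross_weight -big_split; apply: eq_bigr => x _; rewrite big_cat.
Qed.

Lemma cross_weight_perm u u' v v' :
  perm_eq u u' -> perm_eq v v' -> cross_weight u v = cross_weight u' v'.
Proof.
move=> uu' vv'; rewrite /cross_weight (perm_big _ uu').
by apply: eq_bigr => x _; apply: perm_big.
Qed.

(** A low label before a high one is never an inversion. *)
Lemma cross_weight_low_high n u v : {in u, forall x : 'I_m, (x < n)%N} ->
  {in v, forall y : 'I_m, (n <= y)%N} -> cross_weight u v = 1.
Proof.
move=> un vn; rewrite /cross_weight big_seq big1 // => x /un xn.
rewrite big_seq big1 // => y /vn yn; rewrite /qinv ifN //; lia.
Qed.

Hypothesis q_neq0 : forall i j : 'I_m, (i < j)%N -> q i j != 0.

Lemma cross_weight_neq0 u v : cross_weight u v != 0.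
Proof.
rewrite /cross_weight prodf_seq_neq0; apply/allP => x _ /=.
rewrite prodf_seq_neq0; apply/allP => y _ /=; rewrite /qinv.
by case: ifP => [/q_neq0|] //; rewrite oner_eq0.
Qed.

Lemma inv_weight_neq0 u : inv_weight u != 0.
Proof.
rewrite /inv_weight; elim: u => [|x u IH] /=; first exact: oner_neq0.
have := cross_weight_neq0 [:: x] u; rewrite /cross_weight big_seq1 => x0.
exact: mulf_neq0.
Qed.

Variable n : nat.
Hypothesis q_block : forall i i' j j' : 'I_m, (i < n)%N -> (i' < n)%N ->
  (n <= j)%N -> (n <= j')%N -> q i j = q i' j'.

(** This is where the block condition enters: every pair of a high and a low label contributes the
    same parameter, so only the lengths count. *)
Lemma cross_weight_high_low a b v : size a = size b ->
  {in a, forall x : 'I_m, (n <= x)%N} -> {in b, forall x : 'I_m, (n <= x)%N} ->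
  {in v, forall y : 'I_m, (y < n)%N} -> cross_weight a v = cross_weight b v.
Proof.
move=> + + + vn; elim: a b => [|x a IH] [|y b] //= [ab] an bn.
rewrite /cross_weight !big_cons; congr (_ * _); last first.
  by apply: IH => // z zl; [apply: an | apply: bn]; rewrite inE zl orbT.
have := an x (mem_head _ _); have := bn y (mem_head _ _) => ny nx.
rewrite big_seq [RHS]big_seq; apply: eq_bigr => z /vn zn; rewrite /qinv.
by rewrite !ifT; [exact: q_block | lia | lia].
Qed.

End Weight.

(** * Grading of words by their labels *)

Section Grading.
Variables (m n : nat).
Implicit Types (a b : seq 'I_m) (w : seq ('I_m * 'I_m)).

(* Modulo the labels below n the row (column) labels of w form the multiset a
   (b), and below n the excess of row over column labels is that of a over b. *)
Definition graded a b w : Prop := forall x : 'I_m,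
  if (x < n)%N then
    (count_mem x a + count_mem x (unzip2 w)
       = count_mem x b + count_mem x (unzip1 w))%N
  else count_mem x (unzip1 w) = count_mem x a
       /\ count_mem x (unzip2 w) = count_mem x b.

Lemma graded_nil : graded [::] [::] [::].
Proof. by move=> x; case: ifP. Qed.

Lemma graded_cat a a' b b' w w' : graded a b w -> graded a' b' w' ->
  graded (a ++ a') (b ++ b') (w ++ w').
Proof.
move=> g g' x; move: (g x) (g' x); rewrite /unzip1 /unzip2 !map_cat !count_cat.
by case: ifP => _; lia.
Qed.

Lemma graded_perm a a' b b' w : perm_eq a a' -> perm_eq b b' ->
  graded a b w -> graded a' b' w.
Proof.
by move=> /seq.permP aa' /seq.permP bb' g x; rewrite -aa' -bb'; apply: g.
Qed.

(** Low labels enter only through an excess, so a common low part cancels. This removes the labels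
    of A_0 from the degree of a minor. *)
Lemma graded_catl_low c a b w : {in c, forall x : 'I_m, (x < n)%N} ->
  graded (c ++ a) (c ++ b) w -> graded a b w.
Proof.
move=> cn g x; move: (g x); rewrite !count_cat; case: ifP => xn; first by lia.
have /count_memPn -> // : x \notin c.
by apply: contraFN xn; exact: cn.
Qed.

Let low w := [seq x : 'I_m <- unzip1 w | (x < n)%N].

Lemma count_mem_filter_low (r : seq 'I_m) (x : 'I_m) :
  count_mem x [seq y : 'I_m <- r | (y < n)%N]
  = if (x < n)%N then count_mem x r else 0.
Proof.
elim: r => [|y r IH] /=; first by case: ifP.
case: (ltnP y n) => yn /=; rewrite IH; case: ifP => xn //.
  by case: eqP => // yx; rewrite yx xn in yn.
by case: eqP => // yx; rewrite -yx ltnNge yn in xn.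
Qed.

Lemma graded_rows a b w : {in a, forall x : 'I_m, (n <= x)%N} ->
  graded a b w -> perm_eq (unzip1 w) (a ++ low w).
Proof.
move=> an g; apply: perm_eq_count_mem => x.
rewrite count_cat count_mem_filter_low; move: (g x); case: ifP => xn; last by lia.
have /count_memPn -> // : x \notin a.
by apply/negP => /an; rewrite leqNgt xn.
Qed.

(** For high [a] and [b] the low excess is zero, so rows and columns share their low part; hence
    [low w], read off the rows, also describes the columns. *)
Lemma graded_cols a b w : {in a, forall x : 'I_m, (n <= x)%N} ->
  {in b, forall x : 'I_m, (n <= x)%N} ->
  graded a b w -> perm_eq (unzip2 w) (b ++ low w).
Proof.
move=> an bn g; apply: perm_eq_count_mem => x.
rewrite count_cat count_mem_filter_low; move: (g x); case: ifP => xn; last by lia.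
have /count_memPn -> : x \notin a by apply/negP => /an; rewrite leqNgt xn.
by have /count_memPn -> : x \notin b by apply/negP => /bn; rewrite leqNgt xn.
Qed.

Variables (K : fieldType) (q : 'I_m -> 'I_m -> K).
Hypothesis q_block : forall i i' j j' : 'I_m, (i < n)%N -> (i' < n)%N ->
  (n <= j)%N -> (n <= j')%N -> q i j = q i' j'.

(** Each cross weight splits into four blocks. The low-low blocks of rows and columns coincide, the
    low-high ones are 1, the high-low ones depend only on lengths, and the high-high ones are the
    factors displayed. *)
Lemma cross_weight_graded a a' b b' w w' : size a = size b ->
  {in a ++ b, forall x : 'I_m, (n <= x)%N} ->
  {in a' ++ b', forall x : 'I_m, (n <= x)%N} ->
  graded a b w -> graded a' b' w' ->
  cross_weight q (unzip2 w) (unzip2 w') * cross_weight q a a'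
  = cross_weight q (unzip1 w) (unzip1 w') * cross_weight q b b'.
Proof.
move=> ab abn abn' g g'.
have an : {in a, forall x : 'I_m, (n <= x)%N}.
  by move=> x xl; apply: abn; rewrite mem_cat xl.
have bn : {in b, forall x : 'I_m, (n <= x)%N}.
  by move=> x xl; apply: abn; rewrite mem_cat xl orbT.
have an' : {in a', forall x : 'I_m, (n <= x)%N}.
  by move=> x xl; apply: abn'; rewrite mem_cat xl.
have bn' : {in b', forall x : 'I_m, (n <= x)%N}.
  by move=> x xl; apply: abn'; rewrite mem_cat xl orbT.
have lown w0 : {in low w0, forall x : 'I_m, (x < n)%N}.
  by move=> x; rewrite mem_filter => /andP[].
rewrite (cross_weight_perm q (graded_cols an bn g) (graded_cols an' bn' g')).
rewrite (cross_weight_perm q (graded_rows an g) (graded_rows an' g')).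
rewrite !cross_weight_catl !cross_weight_catr.
rewrite (cross_weight_low_high q (lown w) an') (cross_weight_low_high q (lown w) bn').
by rewrite (cross_weight_high_low q_block ab an bn (lown w')); ring.
Qed.

End Grading.

(** * Supports of series *)

Section Support.
Variables (K : fieldType) (X : Type).
Implicit Types (f g : ncps K X) (P Q S : seq X -> Prop).

Definition supported f P : Prop := forall w, f w != 0 -> P w.

Lemma supported_sub f P Q : (forall w, P w -> Q w) -> supported f P -> supported f Q.
Proof. by move=> PQ fP w /fP /PQ. Qed.

Lemma supported_mul f g P Q S : (forall u v, P u -> Q v -> S (u ++ v)) ->
  supported f P -> supported g Q -> supported (f * g) S.
Proof.
move=> PQS fP gQ w fgw; apply: contrapT => nS; move/eqP: fgw; apply.
rewrite nc_mulE big1 // => i _; apply/eqP; rewrite mulf_eq0.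
have [//|/fP Pu] := eqVneq (f (take i w)) 0.
have [//|/gQ Qv] := eqVneq (g (drop i w)) 0.
by case: nS; rewrite -(cat_take_drop i w); apply: PQS.
Qed.

Lemma supported_add f g P : supported f P -> supported g P -> supported (f + g) P.
Proof.
move=> fP gP w; rewrite nc_addE.
by have [->|/fP] := eqVneq (f w) 0; [rewrite add0r => /gP|].
Qed.

Lemma supported_opp f P : supported f P -> supported (- f) P.
Proof. by move=> fP w; rewrite nc_oppE oppr_eq0 => /fP. Qed.

Lemma supported_sum (I : Type) (r : seq I) (A : pred I) (F : I -> ncps K X) P :
  (forall i, A i -> supported (F i) P) -> supported (\sum_(i <- r | A i) F i) P.
Proof.
move=> FP; apply: (big_ind (fun f => supported f P)) => //.
  by move=> w; rewrite nc_zeroE eqxx.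
by move=> f g; exact: supported_add.
Qed.

Lemma supported_signM f P k : supported f P -> supported ((-1) ^+ k * f) P.
Proof.
rewrite -signr_odd; case: odd; rewrite ?mul1r // mulN1r; exact: supported_opp.
Qed.

Lemma supported_one P : P [::] -> supported 1 P.
Proof. by move=> P0 [|x w] //; rewrite nc_oneE eqxx. Qed.

(** Strong induction on length: at a nonempty word, [f * f^-1 = 1] expresses the coefficient of
    [f^-1] through nonempty prefixes in [f] and shorter suffixes in [f^-1]. *)
Lemma supported_inv f P : P [::] -> (forall u v, P u -> P v -> P (u ++ v)) ->
  supported f P -> f \is a GRing.unit -> supported f^-1 P.
Proof.
move=> P0 Pcat fP uf w; have [k] := ubnP (size w); elim: k w => // k IH w wk fw.
apply: contrapT => nP; move/eqP: fw; apply.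
have f0 : f [::] != 0 by rewrite -nc_unitE.
have := congr1 (fun g : ncps K X => g w) (mulrV uf); rewrite nc_mulE nc_oneE.
case: w wk nP => [|x w] // wk nP; rewrite big_nat_recl // take0 drop0 big1 ?addr0.
  by move/eqP; rewrite mulf_eq0 (negbTE f0) => /eqP.
move=> i _; apply/eqP; rewrite mulf_eq0 /=.
have [//|/fP Pu] := eqVneq (f (x :: take i w)) 0; apply/negPn/negP => h.
case: nP; rewrite -[x :: w](cat_take_drop i.+1); apply: Pcat => //.
by apply: IH h; rewrite /= size_drop; apply: leq_ltn_trans (leq_subr _ _) _.
Qed.

End Support.

(** * Reweighting of products and inverses *)

Section Reweight.
Variables (K : fieldType) (m : nat) (q : 'I_m -> 'I_m -> K).
Local Notation series := (ncps K ('I_m * 'I_m)%type).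
Implicit Types f g : series.

Lemma reweightD f g : reweight q (f + g) = reweight q f + reweight q g.
Proof. by apply: funext => w; rewrite /reweight !nc_addE mulrDr. Qed.

Lemma reweightN f : reweight q (- f) = - reweight q f.
Proof. by apply: funext => w; rewrite /reweight !nc_oppE mulrN. Qed.

Lemma reweightZ k f : reweight q (k *: f) = k *: reweight q f.
Proof. by apply: funext => w; rewrite /reweight !nc_scaleE mulrCA. Qed.

Lemma reweight0 : reweight q 0 = 0.
Proof. by apply: funext => w; rewrite /reweight nc_zeroE mulr0. Qed.

Lemma reweight_sum (I : Type) (r : seq I) (P : pred I) (F : I -> series) :
  reweight q (\sum_(i <- r | P i) F i) = \sum_(i <- r | P i) reweight q (F i).
Proof. exact: (big_morph _ reweightD reweight0). Qed.

Lemma reweight_nil f : reweight q f [::] = f [::].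
Proof. by rewrite /reweight weight_nil mul1r. Qed.

Lemma reweight1 : reweight q 1 = 1.
Proof.
apply: funext => -[|x w]; first by rewrite reweight_nil.
by rewrite /reweight nc_oneE mulr0.
Qed.

Lemma reweight_signM k f : reweight q ((-1) ^+ k * f) = (-1) ^+ k * reweight q f.
Proof. by rewrite -signr_odd; case: odd; rewrite ?mul1r // !mulN1r reweightN. Qed.

Lemma reweightM_scale f g k :
  (forall u v, f u != 0 -> g v != 0 -> cross_weight q (unzip2 u) (unzip2 v)
     / cross_weight q (unzip1 u) (unzip1 v) = k) ->
  reweight q (f * g) = k *: (reweight q f * reweight q g).
Proof.
move=> fgk; apply: funext => w; rewrite nc_scaleE [LHS]/reweight !nc_mulE !mulr_sumr.
apply: eq_bigr => i _; rewrite /reweight.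
have [->|fu] := eqVneq (f (take i w)) 0; first by rewrite mul0r !mulr0 mul0r mulr0.
have [->|gv] := eqVneq (g (drop i w)) 0; first by rewrite !mulr0.
rewrite -(fgk _ _ fu gv) -{1 2}(cat_take_drop i w) /unzip1 /unzip2 !map_cat.
by rewrite weight_cat; ring.
Qed.

Hypothesis q_neq0 : forall i j : 'I_m, (i < j)%N -> q i j != 0.
Variable n : nat.
Hypothesis q_block : forall i i' j j' : 'I_m, (i < n)%N -> (i' < n)%N ->
  (n <= j)%N -> (n <= j')%N -> q i j = q i' j'.

Lemma reweightM_graded f g a a' b b' : size a = size b ->
  {in a ++ b, forall x : 'I_m, (n <= x)%N} ->
  {in a' ++ b', forall x : 'I_m, (n <= x)%N} ->
  supported f (graded n a b) -> supported g (graded n a' b') ->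
  reweight q (f * g) =
    (cross_weight q b b' / cross_weight q a a') *: (reweight q f * reweight q g).
Proof.
move=> ab abn abn' fs gs; apply: reweightM_scale => u v /fs fu /gs gv.
have := cross_weight_graded q_block ab abn abn' fu gv => e.
apply/eqP; rewrite eqr_div ?cross_weight_neq0 //; apply/eqP.
by rewrite e mulrC.
Qed.

(** On balanced words the cross weights of rows and columns agree, because they depend only on
    multisets. *)
Lemma reweightM_balanced f g :
  supported f (fun w => perm_eq (unzip1 w) (unzip2 w)) ->
  supported g (fun w => perm_eq (unzip1 w) (unzip2 w)) ->
  reweight q (f * g) = reweight q f * reweight q g.
Proof.
move=> fs gs; rewrite (@reweightM_scale _ _ 1) ?scale1r // => u v /fs fu /gs gv.
by rewrite (cross_weight_perm q fu gv) divff // cross_weight_neq0.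
Qed.

Lemma reweightV f : supported f (fun w => perm_eq (unzip1 w) (unzip2 w)) ->
  f \is a GRing.unit -> reweight q f^-1 = (reweight q f)^-1.
Proof.
move=> fs uf; have urf : reweight q f \is a GRing.unit.
  by rewrite nc_unitE reweight_nil -nc_unitE.
rewrite -[LHS]mulr1 -(mulrV urf) mulrA -reweightM_balanced //.
  by rewrite mulVr // reweight1 mul1r.
apply: supported_inv => // u v uu vv; rewrite /unzip1 /unzip2 !map_cat.
exact: perm_cat.
Qed.

(** A single pair of labels has weight 1, and each further factor contributes the cross weights of
    its labels with those to its right; together these scalars build up the weight of the two label
    words. *)
Lemma reweight_prod_graded (c : 'I_m -> 'I_m -> series) (s : 'I_m -> 'I_m) (r : seq 'I_m) :
  {in r, forall j : 'I_m, (n <= j)%N /\ (n <= s j)%N} ->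
  {in r, forall j, supported (c (s j) j) (graded n [:: s j] [:: j])} ->
  reweight q (\prod_(j <- r) c (s j) j)
    = weight q (map s r) r *: \prod_(j <- r) reweight q (c (s j) j).
Proof.
move=> rn cs.
suff [] : supported (\prod_(j <- r) c (s j) j) (graded n (map s r) r) /\
  reweight q (\prod_(j <- r) c (s j) j)
    = weight q (map s r) r *: \prod_(j <- r) reweight q (c (s j) j) by [].
elim: r rn cs => [|j r IH] rn cs.
  rewrite !big_nil reweight1 weight_nil scale1r; split=> //.
  by apply: supported_one; apply: graded_nil.
have [||rs e] := IH.
- by move=> i ir; apply: rn; rewrite inE ir orbT.
- by move=> i ir; apply: cs; rewrite inE ir orbT.
have js := cs j (mem_head _ _); rewrite !big_cons; split.
  by apply: supported_mul js rs => u v; exact: (@graded_cat _ _ [:: _] _ [:: _]).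
have [jn sjn] := rn j (mem_head _ _).
rewrite (reweightM_graded _ _ _ js rs) //=.
- rewrite e -scalerAr scalerA; congr (_ *: _).
  have /= -> := weight_cat q [:: s j] (map s r) [:: j] r.
  rewrite mulrC; congr (_ * _).
  by rewrite !weightE /inv_weight /= !big_nil !mulr1 divr1 mul1r.
- by move=> x; rewrite !inE => /orP[] /eqP ->.
- move=> x; rewrite mem_cat => /orP[/mapP[i ir ->]|ir].
    by have [] := rn i _; rewrite // inE ir orbT.
  by have [] := rn x _; rewrite // inE ir orbT.
Qed.

End Reweight.

(** * Words as series, and closed ideals *)

Section Monomials.
Variables (K : fieldType) (X : finType).
Local Notation series := (ncps K X).
Implicit Types (f g : series) (u v w : seq X).

Definition monomial u : series := fun w => (w == u)%:R.

Lemma nc_sumE (I : Type) (r : seq I) (P : pred I) (F : I -> series) w :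
  (\sum_(i <- r | P i) F i) w = \sum_(i <- r | P i) F i w.
Proof. exact: (big_morph (fun f : series => f w)). Qed.

Lemma monomial_nil : monomial [::] = 1.
Proof. by apply: funext => w; rewrite /monomial nc_oneE; case: w. Qed.

Lemma letter_mul_nil x f : (letter K x * f) [::] = 0.
Proof. by rewrite nc_mul_nil mul0r. Qed.

Lemma letter_mul_cons x f y w : (letter K x * f) (y :: w) = (y == x)%:R * f w.
Proof.
rewrite nc_mulE big_nat_recl // take0 {1}/letter mul0r add0r /=.
rewrite big_nat_recl // take0 drop0.
rewrite big_nat big1 ?addr0 => [|i /= iw].
  by rewrite /letter eqseq_cons eqxx andbT.
rewrite /letter eqseq_cons -size_eq0 size_takel // ?andbF ?mul0r //.
Qed.

Lemma mul_letter_nil x f : (f * letter K x) [::] = 0.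
Proof. by rewrite nc_mul_nil mulr0. Qed.

Lemma mul_letter_rcons x f w y : (f * letter K x) (rcons w y) = f w * (y == x)%:R.
Proof.
rewrite nc_mulE size_rcons !big_nat_recr //= -(size_rcons w y) drop_size.
rewrite {2}/letter mulr0 addr0.
rewrite big_nat big1 ?add0r => [|i /= iw].
  rewrite -cats1 take_size_cat // drop_size_cat //.
  by rewrite /letter eqseq_cons eqxx andbT.
suff /negbTE d : drop i (rcons w y) != [:: x] by rewrite /letter d mulr0.
apply/eqP => /(congr1 size); rewrite size_drop size_rcons /=; lia.
Qed.

Lemma monomial_cons x u : monomial (x :: u) = letter K x * monomial u.
Proof.
apply: funext => -[|y w]; first by rewrite letter_mul_nil.
by rewrite letter_mul_cons /monomial eqseq_cons -mulnb natrM.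
Qed.

Lemma monomial_cat u v : monomial (u ++ v) = monomial u * monomial v.
Proof.
elim: u => [|x u IH]; first by rewrite monomial_nil mul1r.
by rewrite cat_cons !monomial_cons IH mulrA.
Qed.

Lemma monomial_mul_small u f w : (size w < size u)%N -> (monomial u * f) w = 0.
Proof.
move=> wu; rewrite nc_mulE big1 // => i _.
suff /negbTE t : take i w != u by rewrite /monomial t mul0r.
by apply: contraTneq wu => <-; rewrite size_take -leqNgt; case: ifP => // /ltnW.
Qed.

Lemma mul_monomial_small u f w : (size w < size u)%N -> (f * monomial u) w = 0.
Proof.
move=> wu; rewrite nc_mulE big1 // => i _.
suff /negbTE t : drop i w != u by rewrite /monomial t mulr0.
by apply: contraTneq wu => <-; rewrite size_drop -leqNgt leq_subr.
Qed.

(** Iterated [d] times, this leaves scalar multiples of words and a remainder supported in length at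
    least [d]. *)
Lemma series_expandl f :
  f = f [::] *: 1 + \sum_x letter K x * ((fun w => f (x :: w)) : series).
Proof.
apply: funext => -[|y w]; rewrite nc_addE nc_scaleE nc_oneE nc_sumE /=.
  by rewrite mulr1 big1 ?addr0 // => x _; rewrite letter_mul_nil.
rewrite mulr0 add0r (bigD1 y) //= letter_mul_cons eqxx mul1r big1 ?addr0 // => x xy.
by rewrite letter_mul_cons eq_sym (negbTE xy) mul0r.
Qed.

Lemma series_expandr f :
  f = f [::] *: 1 + \sum_x ((fun w => f (rcons w x)) : series) * letter K x.
Proof.
apply: funext => w; case/lastP: w => [|w y]; rewrite nc_addE nc_scaleE nc_oneE nc_sumE.
  by rewrite mulr1 big1 ?addr0 // => x _; rewrite mul_letter_nil.
rewrite (bigD1 y) //= mul_letter_rcons eqxx mulr1 big1 ?addr0.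
  by rewrite /nilp size_rcons mulr0 add0r.
by move=> x xy; rewrite mul_letter_rcons eq_sym (negbTE xy) mulr0.
Qed.

Variable S : series -> Prop.

Lemma closed_ideal_two_sided : two_sided_ideal (closed_ideal S).
Proof.
split=> [I tI _ _|f g If Ig I tI cI SI|f g h Ig I tI cI SI]; case: (tI) => I0 ID IM //.
  by apply: ID; [apply: If | apply: Ig].
by apply: IM; apply: Ig.
Qed.

Lemma closed_ideal_closed : nc_closed (closed_ideal S).
Proof.
move=> f fS I tI cI SI; apply: (cI) => d; have [g Ig gf] := fS d.
by exists g; [exact: (Ig I tI cI SI) | exact: gf].
Qed.

Lemma closed_ideal_sub g : S g -> closed_ideal S g.
Proof. by move=> Sg I _ _; apply. Qed.

Lemma closed_idealZ a g : closed_ideal S g -> closed_ideal S (a *: g).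
Proof.
have [_ _ IM] := closed_ideal_two_sided.
by move/(IM a%:A _ 1); rewrite mulr1 -scalerAl mul1r.
Qed.

End Monomials.

Lemma ideal_congruence (K : fieldType) (X : finType) (J : ncps K X -> Prop) :
  two_sided_ideal J -> ring_congruence (fun f g => J (f - g)).
Proof.
move=> [J0 JD JM].
have JN f : J f -> J (- f) by move/(JM (-1) _ 1); rewrite mulr1 mulN1r.
split=> [x|x y xy|x y z xy yz|x x' y y' xx yy|x x' y y' xx yy].
- by rewrite subrr.
- by rewrite -opprB; apply: JN.
- by rewrite -(subrKA y); apply: JD.
- by rewrite opprD addrACA; apply: JD.
- have -> : x * y - x' * y' = 1 * (x - x') * y + x' * (y - y') * 1.
    by rewrite mul1r mulr1 mulrBl mulrBr addrA subrK.
  by apply: JD; apply: JM.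
Qed.

(** * Pulling the ideal of q-relations back along [reweight] *)

Section TwistedIdeal.
Variables (K : fieldType) (m : nat) (q : 'I_m -> 'I_m -> K).
Hypothesis q_neq0 : forall i j : 'I_m, (i < j)%N -> q i j != 0.
Local Notation series := (ncps K ('I_m * 'I_m)%type).
Local Notation I := (closed_ideal (qCF_relation q)).
Implicit Types f g : series.

(* Multiplying by words before reweighting makes this an ideal although
   reweight is not multiplicative; it contains the relations with all q = 1. *)
Definition twisted_ideal f : Prop :=
  forall u v, I (reweight q (monomial K u * f * monomial K v)).

Let approx d f : Prop := exists2 r, I r & forall w, (size w < d)%N -> r w = f w.

Let approxD d f g : approx d f -> approx d g -> approx d (f + g).
Proof.
have [_ ID _] := closed_ideal_two_sided (qCF_relation q).
move=> [r Ir rf] [t It tg]; exists (r + t); first exact: ID.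
by move=> w wd; rewrite !nc_addE rf // tg.
Qed.

Let approx0 d f : (forall w, (size w < d)%N -> f w = 0) -> approx d f.
Proof.
have [I0 _ _] := closed_ideal_two_sided (qCF_relation q).
by move=> f0; exists 0 => // w /f0 ->.
Qed.

Let approx_sum d (T : finType) (F : T -> series) :
  (forall x, approx d (F x)) -> approx d (\sum_x F x).
Proof.
move=> aF; apply: (big_ind (approx d)) => // [|f g]; last exact: approxD.
exact: approx0.
Qed.

(** A series factor cannot be taken out of [reweight], so [f] is expanded letter by letter. Each
    split-off word gives a member of the ideal, the remainder vanishes in low degrees, and
    closedness concludes. *)
Lemma twisted_ideal_mull f g :
  (forall u, I (reweight q (monomial K u * g))) -> I (reweight q (f * g)).
Proof.
move=> Ig; apply: closed_ideal_closed => d.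
(* Here [u] is the word already split off and [k] bounds the letters still to be split; once [u] has
   length [d], nothing remains below degree [d]. *)
suff H k u h : (d <= size u + k)%N -> approx d (reweight q (monomial K u * h * g)).
  by have := H d [::] f (leqnn d); rewrite monomial_nil mul1r.
elim: k u h => [|k IH] u h; rewrite ?addn0 => du.
  apply: approx0 => w wd; rewrite /reweight -mulrA monomial_mul_small ?mulr0 //.
  exact: leq_trans wd du.
rewrite [h]series_expandl mulrDr mulrDl -scalerAr mulr1 -scalerAl reweightD reweightZ.
apply: approxD.
  by exists (h [::] *: reweight q (monomial K u * g)) => //; exact: closed_idealZ.
rewrite mulr_sumr mulr_suml reweight_sum; apply: approx_sum => x.
rewrite (mulrA (monomial K u)).
have -> : monomial K u * letter K x = monomial K (rcons u x).
  by rewrite -cats1 monomial_cat.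
by apply: IH; rewrite size_rcons addSnnS.
Qed.

Lemma twisted_ideal_mulr f g :
  (forall u, I (reweight q (g * monomial K u))) -> I (reweight q (g * f)).
Proof.
move=> Ig; apply: closed_ideal_closed => d.
suff H k u h : (d <= size u + k)%N -> approx d (reweight q (g * (h * monomial K u))).
  by have := H d [::] f (leqnn d); rewrite monomial_nil mulr1.
elim: k u h => [|k IH] u h; rewrite ?addn0 => du.
  apply: approx0 => w wd; rewrite /reweight mulrA mul_monomial_small ?mulr0 //.
  exact: leq_trans wd du.
rewrite [h]series_expandr mulrDl mulrDr -scalerAl mul1r -scalerAr reweightD reweightZ.
apply: approxD.
  by exists (h [::] *: reweight q (g * monomial K u)) => //; exact: closed_idealZ.
rewrite mulr_suml mulr_sumr reweight_sum; apply: approx_sum => x.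
by rewrite -mulrA -monomial_cons; apply: IH; rewrite /= addSnnS.
Qed.

Lemma twisted_ideal_two_sided : two_sided_ideal twisted_ideal.
Proof.
have [I0 ID IM] := closed_ideal_two_sided (qCF_relation q).
split=> [u v|f g If Ig u v|f g h Ig u v].
- by rewrite mulr0 mul0r reweight0.
- by rewrite mulrDr mulrDl reweightD; apply: ID.
- have -> : monomial K u * (f * g * h) * monomial K v
      = monomial K u * f * (g * (h * monomial K v)) by rewrite !mulrA.
  apply: twisted_ideal_mull => u'; rewrite (mulrA (monomial K u')).
  by apply: (@twisted_ideal_mulr (h * monomial K v) (monomial K u' * g)) => v'; exact: (Ig u' v').
Qed.

Lemma twisted_idealN f : twisted_ideal f -> twisted_ideal (- f).
Proof.
have [_ _ JM] := twisted_ideal_two_sided.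
by move/(JM (-1) _ 1); rewrite mulr1 mulN1r.
Qed.

Lemma twisted_ideal_reweight f : twisted_ideal f -> I (reweight q f).
Proof. by move/(_ [::] [::]); rewrite monomial_nil mul1r mulr1. Qed.

Lemma reweight_monomial u :
  reweight q (monomial K u) = weight q (unzip1 u) (unzip2 u) *: monomial K u.
Proof.
apply: funext => w; rewrite nc_scaleE /reweight /monomial.
by case: eqP => [->|]; rewrite ?mulr0.
Qed.

Lemma inv_weight_swap (x y : 'I_m) u v : (x < y)%N ->
  inv_weight q (u ++ [:: y, x & v]) = inv_weight q (u ++ [:: x, y & v]) * q x y.
Proof.
move=> xy; rewrite !inv_weight_cat.
have /(cross_weight_perm q (perm_refl u)) -> :
  perm_eq [:: y, x & v] [:: x, y & v] by rewrite (perm_catCA [:: y] [:: x]).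
rewrite /inv_weight /= !big_cons xy [(y < x)%N]ltnNge ltnW //=; ring.
Qed.

(** The two words differ by a swap of adjacent row labels and of adjacent column labels. Each swap
    of distinct labels changes the weight by one parameter, so the ratio of the weights is that of
    the coefficients in the q-relation; its three forms are the cases k < l, k > l and k = l. *)
Lemma twisted_ideal_commutator (i j k l : 'I_m) : i != j ->
  twisted_ideal (letter K (i, k) * letter K (j, l)
                 - letter K (j, l) * letter K (i, k)).
Proof.
wlog ij : i j k l / (i < j)%N => [H ij|_].
  have [||e] := ltngtP i j; first by move=> h; exact: H.
    by move=> h; rewrite -opprB; apply: twisted_idealN; apply: H; rewrite // eq_sym.
  by rewrite (val_inj e) eqxx in ij.
have [_ _ IM] := closed_ideal_two_sided (qCF_relation q).
move=> u v; rewrite mulrBr mulrBl.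
have word x y : monomial K u * (letter K x * letter K y) * monomial K v
    = monomial K (u ++ [:: x, y & v]).
  by rewrite monomial_cat !monomial_cons !mulrA.
rewrite !word reweightD reweightN !reweight_monomial -!word.
set wt1 := weight _ _ _; set wt2 := weight _ _ _.
(* The scalar [c] matches the coefficients [a], [b] of the relation [r] with the two weights. *)
have rel r c : qCF_relation q r -> forall a b,
    r = a *: (letter K (j, l) * letter K (i, k))
        - b *: (letter K (i, k) * letter K (j, l)) ->
    wt1 = c * b -> wt2 = c * a ->
  I (wt1 *: (monomial K u * (letter K (i, k) * letter K (j, l)) * monomial K v)
   - wt2 *: (monomial K u * (letter K (j, l) * letter K (i, k)) * monomial K v)).
  move=> Sr a b rE -> ->.
  have := closed_idealZ (- c) (IM (monomial K u) r (monomial K v) (closed_ideal_sub Sr)).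
  rewrite rE mulrBr mulrBl -!scalerAr -!scalerAl scalerBr !scalerA !mulNr !scaleNr.
  by rewrite opprK addrC.
have W0 := inv_weight_neq0 q_neq0; have qij := q_neq0 ij.
have : wt2 = inv_weight q (unzip2 u ++ [:: l, k & unzip2 v])
           / (inv_weight q (unzip1 u ++ [:: i, j & unzip1 v]) * q i j).
  by rewrite /wt2 weightE /unzip1 /unzip2 !map_cat /= (inv_weight_swap _ _ ij).
have : wt1 = inv_weight q (unzip2 u ++ [:: k, l & unzip2 v])
           / inv_weight q (unzip1 u ++ [:: i, j & unzip1 v]).
  by rewrite /wt1 weightE /unzip1 /unzip2 !map_cat.
move: wt1 wt2 rel => wt1 wt2 rel.
case: (ltngtP k l) => kl.
- rewrite (inv_weight_swap _ _ kl) => wt1E wt2E.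
  apply: (rel _ (wt1 / q i j) (qCF_lt q ij kl)); first by rewrite /genA !mxE.
    by rewrite divfK.
  by rewrite wt2E wt1E; field; rewrite qij W0.
- rewrite (inv_weight_swap _ _ kl) => wt1E wt2E.
  apply: (rel _ wt2 (qCF_gt q ij kl) 1); first by rewrite /genA !mxE scale1r.
    by rewrite wt2E wt1E; field; rewrite qij W0.
  by rewrite mulr1.
- have {kl} kl : k = l by apply: val_inj.
  subst l; move=> wt1E wt2E.
  apply: (rel _ wt2 (qCF_eq q k ij) 1); first by rewrite /genA !mxE scale1r.
    by rewrite wt2E wt1E; field; rewrite qij W0.
  by rewrite mulr1.
Qed.

End TwistedIdeal.

(** * Expansion of det(I - C) into principal minors *)

Section Expansion.
Variable R : pzRingType.
Implicit Types F H : nat -> nat -> R.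

Lemma prodr_seq_eq0 (I : eqType) (r : seq I) (F : I -> R) x :
  x \in r -> F x = 0 -> \prod_(i <- r) F i = 0.
Proof.
by case/splitPr => r1 r2 Fx; rewrite big_cat big_cons /= Fx mul0r mulr0.
Qed.

Lemma prodrN_seq (I : Type) (r : seq I) (F : I -> R) :
  \prod_(i <- r) - F i = (-1) ^+ size r * \prod_(i <- r) F i.
Proof.
elim: r => [|x r IH]; first by rewrite !big_nil mulr1.
by rewrite !big_cons IH mulrA commr_sign exprSr mulrN1 mulrN -mulNr !mulrA.
Qed.

Lemma cong_coldet (E : R -> R -> Prop) N F H : ring_congruence E ->
  (forall i j, (i < N)%N -> (j < N)%N -> E (F i j) (H i j)) ->
  E (coldet N F) (coldet N H).
Proof.
move=> cE FH; apply: (cong_sum cE) => s _.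
apply: (cong_mul cE (cong_refl cE _)); apply: (cong_prod cE) => r _.
exact: FH.
Qed.

Lemma coldet1 F : coldet 1 F = F 0 0.
Proof. by rewrite coldet_recr big_ord1 coldet0 !mul1r. Qed.

Lemma coldet_delta N : coldet N (fun i j => (i == j)%:R) = 1 :> R.
Proof.
elim: N => [|N IH]; first exact: coldet0.
rewrite -addn1 coldet_block => [|i j iN Nj]; last by rewrite ltn_eqF // (leq_trans iN).
by rewrite IH coldet1 eqxx mulr1.
Qed.

(** The set [J] collects the columns from which [- C] rather than the identity is chosen. A term
    vanishes if [J] contains a low column or if [s] moves a point outside [J]. *)
Lemma coldet_delta_sub m n (c : 'I_m -> 'I_m -> R) F :
  (forall i j : 'I_m, F i j = (i == j)%:R -
     (if (n <= i)%N && (n <= j)%N then c i j else 0)) ->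
  coldet m F = \sum_(J : {set 'I_m} | J \subset [set j : 'I_m | (n <= j)%N])
    (-1) ^+ #|J| *
      \sum_(s : 'S_m | perm_on J s) (-1) ^+ s * \prod_(j <- enum J) c (s j) j.
Proof.
move=> FE; pose C (i j : 'I_m) := if (n <= i)%N && (n <= j)%N then c i j else 0.
transitivity (\sum_(J : {set 'I_m}) \sum_(s : 'S_m) (-1) ^+ s *
    \prod_(r < m) (if r \in J then - C (s r) r else (s r == r)%:R)).
  rewrite exchange_big; apply: eq_bigr => s _ /=; rewrite -mulr_sumr; congr (_ * _).
  rewrite -bigA_distr; apply: eq_bigr => r _.
  by rewrite FE addrC.
rewrite [RHS]big_mkcond; apply: eq_bigr => J _.
have zero (s : 'S_m) (x : 'I_m) :
    (if x \in J then - C (s x) x else (s x == x)%:R) = 0 ->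
    \prod_(r < m) (if r \in J then - C (s r) r else (s r == r)%:R) = 0.
  by apply: prodr_seq_eq0; rewrite mem_index_enum.
case: ifPn => [/subsetP Jn|/subsetPn[x xJ xn]]; last first.
  rewrite big1 // => s _; rewrite (zero s x) ?mulr0 // xJ.
  by move: xn; rewrite inE /C => /negbTE ->; rewrite andbF oppr0.
rewrite mulr_sumr [RHS]big_mkcond; apply: eq_bigr => s _.
case: ifPn => [Js|/subsetPn[x xs xJ]]; last first.
  by rewrite (zero s x) ?mulr0 // (negbTE xJ); move: xs; rewrite inE => /negbTE ->.
have -> : \prod_(r < m) (if r \in J then - C (s r) r else (s r == r)%:R)
    = \prod_(j <- enum J) - c (s j) j.
  have -> : enum J = [seq i <- index_enum 'I_m | i \in J].
    by rewrite [index_enum _]unlock.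
  rewrite big_filter [RHS]big_mkcond; apply: eq_bigr => r _ /=.
  case: ifPn => [rJ|rJ]; last by rewrite (out_perm Js) ?eqxx.
  have srJ : s r \in J by rewrite (perm_closed r Js).
  by have := Jn r rJ; have := Jn (s r) srJ; rewrite !inE /C => -> ->.
by rewrite prodrN_seq -cardE !mulrA commr_sign.
Qed.

End Expansion.

(** * The inverse of I - A_0 as a series over paths *)

Section PathSeries.
Variables (K : fieldType) (m n : nat).
Hypothesis nm : (n <= m)%N.
Local Notation series := (ncps K ('I_m * 'I_m)%type).

(* Letters, and below the entries of I - A, are indexed by the natural numbers
   underlying the labels, so that the minors of I - A share one entry function;
   natletter i j is 0 if i or j is not a label. *)
Definition natletter (i j : nat) : series :=
  fun w => ([seq (p.1 : nat, p.2 : nat) | p : 'I_m * 'I_m <- w] == [:: (i, j)])%:R.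

Lemma natletterE (i j : 'I_m) : natletter i j = letter K (i, j).
Proof.
by apply: funext => -[|[k l] [|p w]].
Qed.

Lemma natletter_mul_cons i k (f : series) p w : (i < m)%N -> (k < m)%N ->
  (natletter i k * f) (p :: w)
  = ((p.1 == i :> nat) && (p.2 == k :> nat))%:R * f w.
Proof.
move=> im km; rewrite (natletterE (Ordinal im) (Ordinal km)) letter_mul_cons.
by case: p => a b; rewrite xpair_eqE -!val_eqE.
Qed.

(* The (i, j) entry of (I - A_0)^-1: the coefficient of w is 1 if w is a path
   from i to j through labels below n. *)
Fixpoint path_series (i j : nat) (w : seq ('I_m * 'I_m)) : K :=
  if w is p :: w' then
    if (p.1 == i :> nat) && (p.2 < n)%N then path_series p.2 j w' else 0
  else (i == j)%:R.

Definition entry_IA (i j : nat) : series := (i == j)%:R - natletter i j.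

Lemma nc_natE (b : bool) w : (b%:R : series) w = (b && nilp w)%:R.
Proof. by case: b; rewrite /= ?mulr1n ?mulr0n ?nc_oneE ?nc_zeroE. Qed.

(** A nonempty path from [i] is uniquely a first letter followed by a path. The identity is exact in
    the free algebra, not merely modulo the relations. *)
Lemma path_seriesE i j : (i < n)%N ->
  \sum_(0 <= l < n) entry_IA i l * (path_series l j : series) = (i == j)%:R.
Proof.
move=> i_n; under eq_bigr do rewrite mulrBl.
rewrite sumrB; apply/eqP; rewrite subr_eq; apply/eqP.
rewrite big_mkord (bigD1 (Ordinal i_n)) //= eqxx mul1r big1 ?addr0; last first.
  by move=> l; rewrite -val_eqE /= eq_sym => /negbTE ->; rewrite mul0r.
rewrite big_mkord; apply: funext => -[|p w]; rewrite nc_addE nc_natE nc_sumE.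
  by rewrite andbT big1 ?addr0 // => l _; rewrite nc_mul_nil mul0r.
rewrite andbF add0r.
under eq_bigr => l _.
  rewrite natletter_mul_cons ?(leq_trans i_n) ?(leq_trans (ltn_ord l)) //; over.
rewrite /=; case: eqP => [_|_]; last by rewrite big1 // => l _; rewrite mul0r.
case: ltnP => pn /=; last first.
  rewrite big1 // => l _; rewrite gtn_eqF ?mul0r //.
  exact: leq_trans (ltn_ord l) pn.
rewrite (bigD1 (Ordinal pn)) //= eqxx mul1r big1 ?addr0 // => l.
by rewrite -val_eqE /= eq_sym => /negbTE ->; rewrite mul0r.
Qed.

End PathSeries.

(** * The identity for commuting rows *)

Section CommutingRows.
Variables (K : fieldType) (m n : nat).
Hypothesis nm : (n <= m)%N.
Local Notation series := (ncps K ('I_m * 'I_m)%type).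
Variable J : series -> Prop.
Hypothesis ideal_J : two_sided_ideal J.
Hypothesis J_comm : forall i j k l : 'I_m, i != j ->
  J (letter K (i, k) * letter K (j, l) - letter K (j, l) * letter K (i, k)).
Local Notation E := (fun f g : series => J (f - g)).
Local Notation a := (@natletter K m).
Local Notation F := (@entry_IA K m).

Let cE : ring_congruence E := ideal_congruence ideal_J.

(** The constants 0 and 1 are central, so the commutator of two entries is that of their letters. *)
Lemma cong_nat_sub_natletter (b b' : bool) i j k l : (i < m)%N -> (j < m)%N ->
  (k < m)%N -> (l < m)%N -> i != j ->
  E ((b%:R - a i k) * (b'%:R - a j l)) ((b'%:R - a j l) * (b%:R - a i k)).
Proof.
move=> im jm km lm ij.
have expand (x y : series) (c c' : bool) :
    (c%:R - x) * (c'%:R - y) = (c%:R * c'%:R - c%:R * y - x * c'%:R) + x * y.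
  by rewrite mulrBl !mulrBr opprB addrA addrAC.
have -> : (b%:R - a i k) * (b'%:R - a j l) - (b'%:R - a j l) * (b%:R - a i k)
    = a i k * a j l - a j l * a i k.
  rewrite !expand opprD addrACA [X in X + _](_ : _ = 0) ?add0r //.
  apply/eqP; rewrite subr_eq0; apply/eqP.
  by rewrite -!(commr_nat _ b') -!(commr_nat _ b) addrAC.
rewrite (natletterE K (Ordinal im) (Ordinal km)).
by rewrite (natletterE K (Ordinal jm) (Ordinal lm)); apply: J_comm.
Qed.

(** For [l < n <= j], the entry of (I - A_0)^-1 A_12. *)
Definition path_cols (l j : nat) : series :=
  \sum_(0 <= p < n) (@path_series K m n l p : series) * a p j.

(** For [n <= i], [F i l] is minus the letter, so this is an entry of A_22 + A_21 (I - A_0)^-1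
    A_12. *)
Definition schur_entry (i j : nat) : series :=
  a i j - \sum_(0 <= l < n) F i l * path_cols l j.

Lemma sum_entry_path_cols i j : (i < n)%N ->
  \sum_(0 <= l < n) F i l * path_cols l j = a i j.
Proof.
move=> i_n; under eq_bigr do rewrite mulr_sumr.
rewrite exchange_big /=.
under eq_bigr => p _.
  under eq_bigr do rewrite mulrA.
  rewrite -mulr_suml path_seriesE //; over.
rewrite big_mkord (bigD1 (Ordinal i_n)) //= eqxx mul1r big1 ?addr0 // => p.
by rewrite -val_eqE /= eq_sym => /negbTE ->; rewrite mul0r.
Qed.

Lemma coldet_IA_schur : E (coldet m F)
  (coldet n F * coldet (m - n)
     (fun i j => (i == j)%:R - schur_entry (n + i) (n + j))).
Proof.
rewrite (eq_coldet (N := m - n) (G := fun i j => F (n + i) (n + j)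
    + \sum_(0 <= l < n) F (n + i) l * path_cols l (n + j))) => [|i j _ _]; last first.
  by rewrite /schur_entry opprB addrCA addrC /entry_IA eqn_add2l.
have := @coldet_schur _ _ cE n (m - n) F path_cols; rewrite subnKC //.
apply=> [r r' c c' rm rm' rr' cm cm'|i j i_n nj].
  exact: cong_nat_sub_natletter.
by rewrite sum_entry_path_cols // subrK ltn_eqF // (leq_trans i_n).
Qed.

(** Index [n] stands for the label [i] in rows and [j] in columns. The corner is a separate case
    because [F i j] would contain an extra 1 when [i = j]. *)
Definition bordered_entry (i j r s : nat) : series :=
  if (n <= r)%N && (n <= s)%N then - a i j
  else F (if (r < n)%N then r else i) (if (s < n)%N then s else j).

Lemma coldet_bordered_schur i j :
  (n <= i)%N -> (i < m)%N -> (n <= j)%N -> (j < m)%N ->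
  E (coldet (n + 1) (bordered_entry i j)) (coldet n F * - schur_entry i j).
Proof.
move=> ni im nj jm.
have := @coldet_schur _ _ cE n 1 (bordered_entry i j) (fun l _ => path_cols l j).
rewrite coldet1 !addn0 (eq_coldet (N := n) (G := F)) => [|r s rn sn]; last first.
  by rewrite /bordered_entry rn sn [(n <= r)%N]leqNgt rn.
have -> : bordered_entry i j n n
    + \sum_(0 <= l < n) bordered_entry i j n l * path_cols l j = - schur_entry i j.
  rewrite {1}/bordered_entry leqnn opprB addrC; congr (_ + _).
  apply: eq_big_nat => l /andP[_ ln].
  by rewrite /bordered_entry leqnn ltnn ln [(n <= l)%N]leqNgt ln.
apply=> [r r' c c' rm rm' rr' cm cm'|r s rn ns].
  have entry x y : (x < n + 1)%N -> (y < n + 1)%N ->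
    exists b : bool, bordered_entry i j x y =
      b%:R - a (if (x < n)%N then x else i) (if (y < n)%N then y else j).
    move=> xn yn; rewrite /bordered_entry; case: ifPn => [/andP[nx ny]|_].
      by exists false; rewrite sub0r ![(_ < n)%N]ltnNge nx ny.
    by eexists; rewrite /entry_IA.
  have [b ->] := entry r c rm cm; have [b' ->] := entry r' c' rm' cm'.
  by apply: cong_nat_sub_natletter; repeat (case: ifP => ?); lia.
rewrite /bordered_entry [(n <= r)%N]leqNgt rn /= [(s < n)%N]ltnNge ns /=.
rewrite (eq_big_nat _ _ (F2 := fun l => F r l * path_cols l j)).
  by rewrite sum_entry_path_cols // subrK ltn_eqF // (leq_trans rn).
by move=> l /andP[_ ln]; rewrite ln.
Qed.

(* The Sylvester identity with all parameters q equal to 1. *)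
Lemma cong_sylvester (c : 'I_m -> 'I_m -> series) :
  coldet n F \is a GRing.unit ->
  (forall i j : 'I_m, (n <= i)%N -> (n <= j)%N ->
     c i j = - ((coldet n F)^-1 * coldet (n + 1) (bordered_entry i j))) ->
  E ((coldet n F)^-1 * coldet m F)
    (\sum_(S : {set 'I_m} | S \subset [set j : 'I_m | (n <= j)%N])
       (-1) ^+ #|S| *
       \sum_(s : 'S_m | perm_on S s) (-1) ^+ s * \prod_(j <- enum S) c (s j) j).
Proof.
move=> uD cDef; set D := coldet n F in uD cDef *.
have cS (i j : 'I_m) : (n <= i)%N -> (n <= j)%N -> E (c i j) (schur_entry i j).
  move=> ni nj; rewrite cDef // -[schur_entry i j]opprK -[- schur_entry i j](mulKr uD).
  apply: (cong_opp cE); apply: (cong_mul cE (cong_refl cE _)).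
  exact: coldet_bordered_schur.
pose c' (i j : nat) := if insub i is Some i' then
  if insub j is Some j' then c i' j' else 0 else 0.
have c'E (i j : 'I_m) : c' i j = c i j by rewrite /c' !valK.
(* The block matrix diag(I_n, I - C), of size [m], so that the sum over permutations of all labels
   becomes a determinant. *)
pose H i j := (i == j)%:R - (if (n <= i)%N && (n <= j)%N then c' i j else 0).
rewrite -(coldet_delta_sub (F := H)); last by move=> i j; rewrite /H c'E.
have -> : coldet m H = coldet (m - n) (fun i j => (i == j)%:R - c' (n + i)%N (n + j)%N).
  transitivity (coldet (n + (m - n)) H); first by rewrite subnKC.
  rewrite coldet_block => [|i j i_n nj]; last first.
    by rewrite /H [(n <= i)%N]leqNgt i_n subr0 ltn_eqF // (leq_trans i_n).
  rewrite (eq_coldet (G := fun i j => (i == j)%:R)) => [|i j i_n _]; last first.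
    by rewrite /H [(n <= i)%N]leqNgt i_n subr0.
  rewrite coldet_delta mul1r; apply: eq_coldet => i j _ _.
  by rewrite /H !leq_addr eqn_add2l.
apply: (cong_trans cE (y := D^-1 * (D * coldet (m - n)
     (fun i j => (i == j)%:R - schur_entry (n + i) (n + j))))).
  exact: (cong_mul cE (cong_refl cE _) coldet_IA_schur).
rewrite mulKr //; apply: (cong_coldet cE) => i j i_mn j_mn.
apply: (cong_add cE (cong_refl cE _)); apply: (cong_opp cE).
have im : (n + i < m)%N by lia.
have jm : (n + j < m)%N by lia.
apply: (cong_sym cE); rewrite (c'E (Ordinal im) (Ordinal jm)).
by apply: cS; exact: leq_addr.
Qed.

End CommutingRows.

(** * Transfer to the q-determinants *)

(** The determinant before reweighting: [detq q B] is convertible to [reweight q (ncdet B)]. *)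
Definition ncdet (R : pzRingType) N (B : 'M[R]_N) : R :=
  \sum_(s : 'S_N)
    (-1) ^+ Defs.inv [seq s r | r <- enum 'I_N] * \prod_(r < N) B (s r) r.

Lemma ncdet_coldet (R : pzRingType) N (B : 'M[R]_N) (F : nat -> nat -> R) :
  (forall r s : 'I_N, B r s = F r s) -> ncdet B = coldet N F.
Proof.
move=> BF; apply: eq_bigr => s _; congr (_ * _); last by apply: eq_bigr => r _.
have onT : perm_on [set: 'I_N] s by apply/subsetP => x _; rewrite inE.
by rewrite -(sign_inv_perm_on _ onT) (eq_enum (in_setT (T := 'I_N))).
Qed.

Section Assembly.
Variables (K : fieldType) (m n : nat) (q : 'I_m -> 'I_m -> K).
Hypothesis nm : (n < m)%N.
Hypothesis q_neq0 : forall i j : 'I_m, (i < j)%N -> q i j != 0.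
Hypothesis q_block : forall i i' j j' : 'I_m, (i < n)%N -> (i' < n)%N ->
  (n <= j)%N -> (n <= j')%N -> q i j = q i' j'.
Local Notation series := (ncps K ('I_m * 'I_m)%type).
Let emb : 'I_n -> 'I_m := widen_ord (ltnW nm).

(** Each term of the expansion uses every row and column label once, and degrees ignore order. The
    threshold [k] is [n] for A_0 and its bordered matrices, and [m] for the whole of A, where all
    labels count as low. *)
Lemma supported_ncdet N k (B : 'M[series]_N) (rho kappa : 'I_N -> 'I_m) a b :
  (forall r s, supported (B r s) (graded k [:: rho r] [:: kappa s])) ->
  (forall w, graded k (map rho (enum 'I_N)) (map kappa (enum 'I_N)) w ->
     graded k a b w) ->
  supported (ncdet B) (graded k a b).
Proof.
move=> Bs ab; apply: supported_sum => s _; apply: supported_signM.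
apply: (supported_sub ab); apply: (supported_sub
    (P := graded k (map (rho \o s) (enum 'I_N)) (map kappa (enum 'I_N)))).
  move=> w; apply: graded_perm => //; rewrite map_comp; apply: perm_map.
  apply: uniq_perm => [||x]; first by rewrite (map_inj_uniq perm_inj) enum_uniq.
    exact: enum_uniq.
  by rewrite -[x](permKV s) (mem_map perm_inj) !mem_enum.
rewrite [index_enum _]unlock -enumT; elim: (enum _) => [|r l IH] /=.
  by rewrite big_nil; apply: supported_one; apply: graded_nil.
rewrite big_cons; apply: supported_mul (Bs (s r) r) IH => u v.
exact: (@graded_cat _ _ [:: _] _ [:: _]).
Qed.

Lemma supported_genA k (i j : 'I_m) :
  supported (genA K m i j) (graded k [:: i] [:: j]).
Proof.
move=> w; rewrite !mxE /letter; case: (w =P [:: (i, j)]) => [-> _|_]; last by rewrite eqxx.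
by move=> x /=; case: ifP => //; lia.
Qed.

(** The reason for grading low labels by excess only: the 1 on the diagonal has no letters, yet must
    have the degree of the letter beside it. *)
Lemma supported_delta_low k (b : bool) (i : 'I_m) : (i < k)%N ->
  supported (b%:R : series) (graded k [:: i] [:: i]).
Proof.
move=> ik; case: b => [|w]; last by rewrite mulr0n nc_zeroE eqxx.
apply: supported_one => x /=; case: ifP => // xk; rewrite addn0; split => //.
all: by case: eqP => // ix; rewrite -ix ik in xk.
Qed.

Lemma supported_IA k (N : nat) (f : 'I_N -> 'I_m) r s :
  (forall r, f r < k)%N -> injective f ->
  supported ((1%:M - mxsub f f (genA K m)) r s) (graded k [:: f r] [:: f s]).
Proof.
move=> fk f_inj; rewrite !mxE; apply: supported_add; last first.
  by apply: supported_opp; have := @supported_genA k (f r) (f s); rewrite mxE.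
have [->|_] := eqVneq r s; first exact: (@supported_delta_low k true _ (fk s)).
by move=> w; rewrite mulr0n nc_zeroE eqxx.
Qed.

Lemma emb_inj : injective emb.
Proof. by move=> r s /(congr1 val) /= /val_inj. Qed.

Lemma supported_ncdet_IA0 :
  supported (ncdet (1%:M - genA0 K nm)) (graded n [::] [::]).
Proof.
apply: (supported_ncdet (rho := emb) (kappa := emb)) => [r s|w].
  by apply: supported_IA emb_inj => r'; apply: (ltn_ord r').
rewrite -[X in graded _ X X]cats0; apply: graded_catl_low => x.
by case/mapP => r _ ->; apply: (ltn_ord r).
Qed.

Lemma supported_ncdet_IA : supported (ncdet (1%:M - genA K m)) (graded m [::] [::]).
Proof.
apply: (supported_ncdet (rho := id) (kappa := id)) => [r s|w].
  have -> : genA K m = mxsub id id (genA K m) by apply/matrixP => i j; rewrite !mxE.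
  by apply: (supported_IA (f := id)) => // r'; apply: ltn_ord.
rewrite -[X in graded _ X X]cats0; apply: graded_catl_low => x _; exact: ltn_ord.
Qed.

Lemma graded_balanced k w : graded k ([::] : seq 'I_m) [::] w -> perm_eq (unzip1 w) (unzip2 w).
Proof.
move=> g; apply: perm_eq_count_mem => x; move: (g x).
by case: ifP => _ /=; [rewrite !add0n | case=> -> ->].
Qed.

Lemma perm_enum_add1 N : perm_eq (enum 'I_(N + 1))
  (rcons [seq lshift 1 r | r <- enum 'I_N] (rshift N ord0)).
Proof.
apply: uniq_perm => [||r]; first exact: enum_uniq.
  rewrite rcons_uniq (map_inj_uniq (@lshift_inj _ _)) enum_uniq andbT.
  by apply/mapP => -[r _ /eqP]; rewrite eq_rlshift.
rewrite mem_enum mem_rcons inE; case: (split_ordP r) => r' ->.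
  by rewrite (mem_map (@lshift_inj _ _)) mem_enum orbT.
by rewrite ord1 eqxx.
Qed.

Lemma supported_ncdet_bordered (i j : 'I_m) : (n <= i)%N -> (n <= j)%N ->
  supported (ncdet (bordered K nm i j)) (graded n [:: i] [:: j]).
Proof.
move=> ni nj; pose lab (k : 'I_m) (r : 'I_(n + 1)) :=
  if split r is inl r' then emb r' else k.
have lab_l k r : lab k (lshift 1 r) = emb r.
  by rewrite /lab; case: split_ordP => [r' /lshift_inj ->|r' /eqP] //; rewrite eq_lrshift.
have lab_r k r : lab k (rshift n r) = k.
  by rewrite /lab; case: split_ordP => [r' /eqP|] //; rewrite eq_rlshift.
apply: (supported_ncdet (rho := lab i) (kappa := lab j)) => [r s|w].
  rewrite /bordered; case: (split_ordP r) => r' ->; case: (split_ordP s) => s' ->.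
  - rewrite block_mxEul !lab_l; apply: supported_IA emb_inj => r''.
    exact: (ltn_ord r'').
  - rewrite block_mxEur lab_l lab_r mxE; apply: supported_opp.
    by rewrite mxE; apply: supported_genA.
  - rewrite block_mxEdl lab_l lab_r mxE; apply: supported_opp.
    by rewrite mxE; apply: supported_genA.
  - rewrite block_mxEdr !lab_r mxE; apply: supported_opp.
    by rewrite !ord1 mxE eqxx mulr1n; apply: supported_genA.
have labE k : perm_eq (map (lab k) (enum 'I_(n + 1))) (map emb (enum 'I_n) ++ [:: k]).
  rewrite (perm_trans (perm_map _ (perm_enum_add1 n))) //.
  by rewrite map_rcons -map_comp lab_r (eq_map (lab_l k)) cats1.
move/(graded_perm (labE i) (labE j)); apply: graded_catl_low => x.
by case/mapP => r _ ->; apply: (ltn_ord r).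
Qed.

Lemma genA_natletter (i j : 'I_m) : genA K m i j = natletter K i j.
Proof. by rewrite mxE natletterE. Qed.

Lemma ncdet_IA0_coldet : ncdet (1%:M - genA0 K nm) = coldet n (@entry_IA K m).
Proof.
apply: ncdet_coldet => r s; rewrite mxE [X in X + _]mxE /entry_IA mxE mxE mxE.
by rewrite -natletterE.
Qed.

Lemma ncdet_IA_coldet : ncdet (1%:M - genA K m) = coldet m (@entry_IA K m).
Proof.
apply: ncdet_coldet => r s; rewrite mxE [X in X + _]mxE /entry_IA mxE.
by rewrite genA_natletter.
Qed.

Lemma ncdet_bordered_coldet (i j : 'I_m) : (n <= i)%N -> (n <= j)%N ->
  ncdet (bordered K nm i j) = coldet (n + 1) (@bordered_entry K m n i j).
Proof.
move=> ni nj; apply: ncdet_coldet => r s; rewrite /bordered /bordered_entry.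
case: (split_ordP r) => r' ->; case: (split_ordP s) => s' ->.
- rewrite block_mxEul /= [(n <= r')%N]leqNgt ltn_ord /=.
  by rewrite mxE [X in X + _]mxE /entry_IA !mxE -natletterE.
- rewrite block_mxEur /= [(n <= r')%N]leqNgt ltn_ord /= !mxE /entry_IA.
  rewrite -natletterE ltn_eqF ?sub0r //.
  exact: leq_trans (ltn_ord r') nj.
- rewrite block_mxEdl /= [(n <= s')%N]leqNgt ltn_ord andbF /= !mxE /entry_IA.
  rewrite -natletterE gtn_eqF ?sub0r //.
  exact: leq_trans (ltn_ord s') ni.
- by rewrite block_mxEdr /= !leq_addr !ord1 !mxE eqxx mulr1n -natletterE.
Qed.

(** The counterpart of [cq] before reweighting, to which the identity for commuting rows applies. *)
Let c (i j : 'I_m) : series :=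
  - ((ncdet (1%:M - genA0 K nm))^-1 * ncdet (bordered K nm i j)).

Lemma ncdet_IA0_unit : ncdet (1%:M - genA0 K nm) \is a GRing.unit.
Proof.
by have := detq_genA0_unit q nm; rewrite !nc_unitE /detq reweight_nil.
Qed.

Lemma supported_ncdet_IA0_inv :
  supported (ncdet (1%:M - genA0 K nm))^-1 (graded n [::] [::]).
Proof.
apply: supported_inv ncdet_IA0_unit => [|u v|]; first exact: graded_nil.
  exact: (@graded_cat _ _ [::] _ [::]).
exact: supported_ncdet_IA0.
Qed.

Lemma supported_c (i j : 'I_m) : (n <= i)%N -> (n <= j)%N ->
  supported (c i j) (graded n [:: i] [:: j]).
Proof.
move=> ni nj; apply: supported_opp.
apply: supported_mul supported_ncdet_IA0_inv (supported_ncdet_bordered ni nj) => u v.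
exact: (@graded_cat _ _ [::] _ [::]).
Qed.

Lemma reweight_IA0_inv : reweight q (ncdet (1%:M - genA0 K nm))^-1
  = (detq q (1%:M - genA0 K nm))^-1.
Proof.
apply: reweightV ncdet_IA0_unit => //.
exact: supported_sub (@graded_balanced n) supported_ncdet_IA0.
Qed.

Lemma reweight_c (i j : 'I_m) : (n <= i)%N -> (n <= j)%N ->
  reweight q (c i j) = cq q nm i j.
Proof.
move=> ni nj; rewrite reweightN; congr (- _).
rewrite (reweightM_graded q_neq0 q_block _ _ _ supported_ncdet_IA0_inv
  (supported_ncdet_bordered ni nj)) //; last first.
  by move=> x; rewrite !inE => /orP[] /eqP ->.
by rewrite /cross_weight !big_nil divr1 scale1r reweight_IA0_inv.
Qed.

Lemma reweight_sylvester_sum :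
  reweight q (\sum_(S : {set 'I_m} | S \subset [set j : 'I_m | (n <= j)%N])
    (-1) ^+ #|S| *
    \sum_(s : 'S_m | perm_on S s) (-1) ^+ s * \prod_(j <- enum S) c (s j) j)
  = detq_IC q n (cq q nm).
Proof.
rewrite reweight_sum; apply: eq_bigr => S /subsetP Sn.
rewrite reweight_signM; congr (_ * _).
rewrite reweight_sum; apply: eq_bigr => s Ss; rewrite reweight_signM.
have high (j : 'I_m) : j \in enum S -> (n <= j)%N /\ (n <= s j)%N.
  rewrite mem_enum => jS; have sjS : s j \in S by rewrite (perm_closed j Ss).
  by have := Sn j jS; have := Sn (s j) sjS; rewrite !inE.
rewrite (reweight_prod_graded q_neq0 q_block high) => [|j /high[nj nsj]]; last first.
  exact: supported_c.
rewrite (sign_inv_perm_on K Ss) -scalerA.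
rewrite big_seq [X in _ = _ *: (_ *: X)]big_seq (eq_bigr (fun j => cq q nm (s j) j)).
  by case: odd_perm; rewrite ?expr0 ?expr1 ?mul1r ?scale1r // mulN1r scaleN1r.
by move=> j /high[nj nsj]; apply: reweight_c.
Qed.

Lemma q_sylvester : qCF_eqmod q
  ((detq q (1%:M - genA0 K nm))^-1 * detq q (1%:M - genA K m))
  (detq_IC q n (cq q nm)).
Proof.
have Dinv := ncdet_IA0_unit; rewrite ncdet_IA0_coldet in Dinv.
have cE (i j : 'I_m) : (n <= i)%N -> (n <= j)%N -> c i j =
    - ((coldet n (@entry_IA K m))^-1 * coldet (n + 1) (@bordered_entry K m n i j)).
  by move=> ni nj; rewrite -ncdet_IA0_coldet -ncdet_bordered_coldet.
have := cong_sylvester (ltnW nm) (twisted_ideal_two_sided q)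
  (twisted_ideal_commutator q_neq0) Dinv cE.
move/twisted_ideal_reweight.
rewrite reweightD reweightN reweight_sylvester_sum -ncdet_IA0_coldet -ncdet_IA_coldet.
rewrite reweightM_balanced ?reweight_IA0_inv //.
  exact: supported_sub (@graded_balanced n) supported_ncdet_IA0_inv.
exact: supported_sub (@graded_balanced m) supported_ncdet_IA.
Qed.

End Assembly.

Theorem theorem9p7 (R : realType) (m n : nat) (q : 'I_m -> 'I_m -> R[i])
  (hn : (1 <= n)%N) (hnm : (n < m)%N)
  (hq0 : forall i j : 'I_m, (i < j)%N -> q i j != 0)
  (hq : forall i i' j j' : 'I_m,
      (i < n)%N -> (i' < n)%N -> (n <= j)%N -> (n <= j')%N -> q i j = q i' j') :
  qCF_eqmod q
    ((detq q (1%:M - genA0 R[i] hnm))^-1 * detq q (1%:M - genA R[i] m))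
    (detq_IC q n (cq q hnm)).
Proof.
exact: q_sylvester.
Qed.
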